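(* Let $f:\mathbb{R}^d\to\mathbb{R}$ be a convex function which is continuous, has at least one minimizer, and satisfies $\int_{\mathbb{R}^d} \exp(-f(y)/\delta)\,dy<+\infty$, and denote $X^{\star}:=\operatorname{argmin} f$. Let $(x^k)_{k\in\mathbb{N}}$ be generated by $x^{k+1}=\operatorname{zprox}^\delta_{\lambda,f}(x^k)$. Then \begin{enumerate} \item[(i)] for every $k\ge 1$, \[ f(x^{k})-\min_y f(y)\leq \|\nabla f^{\lambda,\delta}(x^{k-1})\|\operatorname{dist}(x^{k},X^\star)+ d \delta; \] \item[(ii)] if $f$ is $L$-smooth then \(\|\nabla f(x^k)\| \leq (1+\lambda L) \|\nabla f^{\lambda, \delta}(x^k)\|+ L \sqrt{d \lambda \delta}\) and, in addition to the bound in (i), it also holds \[f(x^k) - \min_y f(y) \leq \left((1+\lambda L) \|\nabla f^{\lambda, \delta}(x^k)\|+ L \sqrt{d \lambda \delta}\right)\operatorname{dist}(x^k,X^\star).\] \end{enumerate} In all the previous inequalities the quantity $\|\nabla f^{\lambda,\delta}(x^k)\|$ can be bounded as \[ \|\nabla f^{\lambda,\delta}(x^k)\| \le \frac{2\,\operatorname{dist}(x^0,X_{\lambda,\delta}^{\star})}{\lambda(k+1)}, \qquad k\ge 1, \] where $X^\star_{\lambda,\delta}:=\operatorname{argmin} f^{\lambda,\delta}$.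
   Context: Fix $\delta>0$ and $\lambda>0$. The zeroth-order proximal operator is $\operatorname{zprox}^\delta_{\lambda,f}(x)=\frac{\mathbb{E}_{y\sim\mathcal{N}(x,\lambda\delta I)}[y\exp(-f(y)/\delta)]}{\mathbb{E}_{y\sim\mathcal{N}(x,\lambda\delta I)}[\exp(-f(y)/\delta)]}$. The soft Moreau envelope is $f^{\lambda,\delta}(x)=-\delta\log\mathbb{E}_{y\sim\mathcal{N}(x,\lambda\delta I)}[\exp(-f(y)/\delta)]$, which satisfies $\operatorname{zprox}^\delta_{\lambda,f}(x)=x-\lambda\nabla f^{\lambda,\delta}(x)$. $d$ is the dimension, $\operatorname{dist}(x,A)$ is the Euclidean distance from $x$ to the set $A$. A function is $L$-smooth if it is $C^1$ with $L$-Lipschitz gradient. *)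

(* Defs.v *)
From HB Require Import structures.
From mathcomp Require Import all_boot all_order all_algebra.
From mathcomp Require Import all_classical all_reals all_analysis.
Set Implicit Arguments.
Unset Strict Implicit.
Unset Printing Implicit Defensive.
Import Order.TTheory GRing.Theory Num.Theory.
Import numFieldNormedType.Exports.
Local Open Scope classical_set_scope.
Local Open Scope ring_scope.

Section Defs.
Context {R : realType}.

(* Euclidean norm on R^d (the matrix norm of mathcomp is the max norm). *)
Definition enorm (d : nat) (v : 'rV[R]_d) : R :=
  Num.sqrt (\sum_(i < d) v ord0 i ^+ 2).

Definition dist (d : nat) (x : 'rV[R]_d) (A : set 'rV[R]_d) : R :=
  inf [set enorm (x - a) | a in A].

Definition argmin (d : nat) (f : 'rV[R]_d -> R) : set 'rV[R]_d :=
  [set x | forall y, f x <= f y].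

Definition minval (d : nat) (f : 'rV[R]_d -> R) : R := inf (range f).

Definition convex_fun (d : nat) (f : 'rV[R]_d -> R) : Prop :=
  forall (x y : 'rV[R]_d) (t : R), 0 <= t -> t <= 1 ->
    f ((1 - t) *: x + t *: y) <= (1 - t) * f x + t * f y.

Definition vcons (d : nat) (t : R) (y : 'rV[R]_d) : 'rV[R]_(d.+1) :=
  row_mx (t%:M : 'rV[R]_1) y.

(* Lebesgue integral over R^d, realized as the iterated one-dimensional
   Lebesgue integral (Fubini/Tonelli).  Extended-real version, used for
   nonnegative integrands. *)
Fixpoint eintRd (d : nat) : ('rV[R]_d -> \bar R) -> \bar R :=
  match d with
  | 0 => fun g => g 0
  | d'.+1 => fun g =>
      (\int[@lebesgue_measure R]_(t in setT) eintRd (fun y => g (vcons t y)))%E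
  end.

Fixpoint RintRd (d : nat) : ('rV[R]_d -> R) -> R :=
  match d with
  | 0 => fun g => g 0
  | d'.+1 => fun g =>
      Rintegral (@lebesgue_measure R) setT (fun t => RintRd (fun y => g (vcons t y)))
  end.

Definition gauss_density (d : nat) (x : 'rV[R]_d) (s2 : R) (y : 'rV[R]_d) : R :=
  (Num.sqrt (pi *+ 2 * s2)) ^- d * expR (- (enorm (y - x) ^+ 2) / (s2 *+ 2)).

Definition gauss_expect (d : nat) (x : 'rV[R]_d) (s2 : R) (g : 'rV[R]_d -> R) : R :=
  RintRd (fun y => g y * gauss_density x s2 y).

Definition zprox (d : nat) (delta lambda : R) (f : 'rV[R]_d -> R) (x : 'rV[R]_d)
  : 'rV[R]_d :=
  \row_(i < d)
    (gauss_expect x (lambda * delta) (fun y => y ord0 i * expR (- f y / delta))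
     / gauss_expect x (lambda * delta) (fun y => expR (- f y / delta))).

Definition soft_moreau (d : nat) (lambda delta : R) (f : 'rV[R]_d -> R)
  (x : 'rV[R]_d) : R :=
  - delta * ln (gauss_expect x (lambda * delta) (fun y => expR (- f y / delta))).

Definition grad (d : nat) (F : 'rV[R]_d -> R) (x : 'rV[R]_d) : 'rV[R]_d :=
  \row_(i < d) ('D_(delta_mx ord0 i) F x).

Definition Lsmooth (d : nat) (L : R) (f : 'rV[R]_d -> R) : Prop :=
  (forall x, differentiable f x) /\
  (forall x y, enorm (grad f x - grad f y) <= L * enorm (x - y)).

End Defs.

(* Main.v *)
(**
Write w_x(y) = exp(-f(y)/delta - |y-x|^2/(2 lambda delta)), Z(x) for its integral
and m(x) = zprox(x) for its mean; F = -delta log Z up to a constant.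

Jensen's inequality gives F(x+h) <= F(x) + <g(x),h> + |h|^2/(2 lambda) with
g(x) = (x-m(x))/lambda, and Prekopa-Leindler gives midpoint convexity of F. Together
they sandwich F between two paraboloids at each point, so grad F = g without
differentiating under the integral, and F is convex and 1/lambda-smooth. The iteration
is thus gradient descent with step lambda, and the potential
|x_k-a|^2 + 2 lambda k (F(x_k)-F(a)) + lambda^2 k(k-1)/2 |g(x_k)|^2 does not increase.

Comparing the integral of w_x with that of its dilation of ratio t < 1 about z and
letting t tend to 1 gives, with V the variance of w_x/Z(x),
f(m) - f(z) + (2V + |m-x|^2 - |z-x|^2 + |m-z|^2)/(2 lambda) <= d delta.
Taking z a minimizer of f gives (i); taking z = m gives V <= d lambda delta, which
controls E|grad f(y) - grad f(x)| in (ii).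

A minimizer of F exists because Z vanishes at infinity. All integrands are continuous
with Gaussian decay, a class stable under partial integration, so the iterated
integrals are handled one variable at a time.
*)
Require Import Defs.
From HB Require Import structures.
From mathcomp Require Import all_boot all_order all_algebra.
From mathcomp Require Import ring lra.
From mathcomp Require Import all_classical all_reals all_analysis.
From mathcomp Require Import measurable_realfun.
Import Order.TTheory GRing.Theory Num.Theory.
Import numFieldNormedType.Exports.
Local Open Scope classical_set_scope.
Local Open Scope ring_scope.
Set Implicit Arguments.
Unset Strict Implicit.
Unset Printing Implicit Defensive.

(** * Euclidean structure on row vectors *)

Definition sq (R : realType) (d : nat) (y : 'rV[R]_d) : R := \sum_(i < d) y ord0
  i ^+ 2.
Definition dot (R : realType) (d : nat) (u v : 'rV[R]_d) : R :=
  \sum_(i < d) u ord0 i * v ord0 i.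

Lemma sq_ge0 (R : realType) d (y : 'rV[R]_d) : 0 <= sq y.
Proof. by apply: sumr_ge0 => i _; exact: sqr_ge0. Qed.

Lemma enorm_ge0 (R : realType) d (y : 'rV[R]_d) : 0 <= enorm y.
Proof. exact: sqrtr_ge0. Qed.

Lemma enorm_sqr (R : realType) d (y : 'rV[R]_d) : enorm y ^+ 2 = sq y.
Proof. by rewrite sqr_sqrtr// sq_ge0. Qed.

Lemma dotvv (R : realType) d (y : 'rV[R]_d) : dot y y = sq y.
Proof. by apply: eq_bigr => i _; rewrite expr2. Qed.

Lemma dotC (R : realType) d (u v : 'rV[R]_d) : dot u v = dot v u.
Proof. by apply: eq_bigr => i _; rewrite mulrC. Qed.

Lemma dotDl (R : realType) d (u v w : 'rV[R]_d) : dot (u + v) w = dot u w + dot v w.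
Proof. by rewrite -big_split; apply: eq_bigr => i _; rewrite mxE mulrDl. Qed.

Lemma dotZl (R : realType) d (a : R) (u w : 'rV[R]_d) : dot (a *: u) w = a * dot u w.
Proof. by rewrite mulr_sumr; apply: eq_bigr => i _; rewrite mxE mulrA. Qed.

Lemma dotNl (R : realType) d (u w : 'rV[R]_d) : dot (- u) w = - dot u w.
Proof. by rewrite -scaleN1r dotZl mulN1r. Qed.

Lemma dotDr (R : realType) d (u v w : 'rV[R]_d) : dot w (u + v) = dot w u + dot w v.
Proof. by rewrite dotC dotDl !(dotC w). Qed.

Lemma dotZr (R : realType) d (a : R) (u w : 'rV[R]_d) : dot w (a *: u) = a * dot w u.
Proof. by rewrite dotC dotZl (dotC w). Qed.

Lemma dotNr (R : realType) d (u w : 'rV[R]_d) : dot w (- u) = - dot w u.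
Proof. by rewrite dotC dotNl (dotC w). Qed.

Definition dotE := (dotDl, dotDr, dotNl, dotNr, dotZl, dotZr).

Lemma dot_le_enorm (R : realType) d (u v : 'rV[R]_d) : dot u v <= enorm u * enorm v.
Proof.
apply: le_trans (ler_norm _) _.
rewrite -(@ler_pXn2r _ 2)// ?nnegrE ?normr_ge0 ?mulr_ge0 ?enorm_ge0//.
rewrite real_normK ?num_real// exprMn !enorm_sqr.
have [v0|v0] := eqVneq (sq v) 0.
  have /psumr_eq0P vi0 : \sum_(i < d) v ord0 i ^+ 2 = 0 by [].
  have -> : dot u v = 0.
    apply: big1 => i _; have /eqP := vi0 (fun i _ => sqr_ge0 _) i isT.
    by rewrite sqrf_eq0 => /eqP ->; rewrite mulr0.
  by rewrite v0 mulr0 expr0n.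
(* This square factors as [sq v] times the Cauchy-Schwarz defect, so nothing is divided; the case
   [sq v = 0], where the factor cannot be cancelled, is settled above. *)
have : 0 <= sq (sq v *: u - dot u v *: v) by exact: sq_ge0.
rewrite -dotvv !dotE (dotC v u) !dotvv.
have := sq_ge0 v; rewrite le_eqVlt eq_sym (negPf v0)/= => vp.
suff E t : 0 <= t -> t = sq v * (sq u * sq v - dot u v ^+ 2) ->
  dot u v ^+ 2 <= sq u * sq v by move=> /E; apply; ring.
by move=> + te; rewrite te pmulr_rge0// subr_ge0.
Qed.

Lemma sqD (R : realType) d (u v : 'rV[R]_d) : sq (u + v) = sq u + dot u v *+ 2 + sq v.
Proof. by rewrite -!dotvv !dotE (dotC v u) mulr2n; ring. Qed.

Lemma sqN (R : realType) d (u : 'rV[R]_d) : sq (- u) = sq u.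
Proof. by rewrite -!dotvv !dotE opprK. Qed.

Lemma sqB (R : realType) d (u v : 'rV[R]_d) : sq (u - v) = sq u - dot u v *+ 2 + sq v.
Proof. by rewrite sqD sqN dotNr mulNrn. Qed.

Lemma sqZ (R : realType) d (a : R) (u : 'rV[R]_d) : sq (a *: u) = a ^+ 2 * sq u.
Proof. by rewrite -!dotvv !dotE mulrA expr2. Qed.

Lemma sqD_le (R : realType) d (u v : 'rV[R]_d) : sq (u + v) <= 2 * sq u + 2 * sq v.
Proof. by have := sq_ge0 (u - v); rewrite sqB sqD; lra. Qed.

Lemma sqBC (R : realType) d (u v : 'rV[R]_d) : sq (u - v) = sq (v - u).
Proof. by rewrite -sqN opprB. Qed.

Lemma enormD (R : realType) d (u v : 'rV[R]_d) : enorm (u + v) <= enorm u + enorm v.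
Proof.
rewrite -(@ler_pXn2r _ 2)// ?nnegrE ?addr_ge0 ?enorm_ge0//.
rewrite enorm_sqr sqD sqrrD !enorm_sqr lerD2r lerD2l lerMn2r/=.
exact: dot_le_enorm.
Qed.

Lemma enormZ (R : realType) d (a : R) (u : 'rV[R]_d) : enorm (a *: u) = `|a| *
    enorm u.
Proof.
by rewrite /enorm -!/(sq _) sqZ sqrtrM ?sqr_ge0// sqrtr_sqr.
Qed.

Lemma enormN (R : realType) d (u : 'rV[R]_d) : enorm (- u) = enorm u.
Proof. by rewrite -scaleN1r enormZ normrN1 mul1r. Qed.

Lemma sq0 (R : realType) d : sq (0 : 'rV[R]_d) = 0.
Proof. by apply: big1 => i _; rewrite mxE expr0n. Qed.

Lemma vcons0 (R : realType) d (t : R) (y : 'rV[R]_d) : vcons t y ord0 ord0 = t.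
Proof.
have -> : ord0 = lshift d (ord0 : 'I_1) by apply/val_inj.
by rewrite [LHS](row_mxEl (t%:M : 'rV_1) y) mxE eqxx mulr1n.
Qed.

Lemma vconsS (R : realType) d (t : R) (y : 'rV[R]_d) i : vcons t y ord0 (lift
    ord0 i) = y ord0 i.
Proof. by rewrite -rshift1 [LHS](row_mxEr (t%:M : 'rV_1) y). Qed.

Lemma vconsP (R : realType) d (u v : 'rV[R]_d.+1) : u ord0 ord0 = v ord0 ord0 ->
  (forall i, u ord0 (lift ord0 i) = v ord0 (lift ord0 i)) -> u = v.
Proof.
move=> h0 hS; apply/rowP => i; case: (unliftP ord0 i) => [j|] ->//.
Qed.

Lemma vconsD (R : realType) d (s t : R) (x y : 'rV[R]_d) :
  vcons s x + vcons t y = vcons (s + t) (x + y).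
Proof. by apply: vconsP => [|i]; rewrite mxE ?vcons0 ?vconsS// mxE. Qed.

Lemma vconsZ (R : realType) d (a t : R) (y : 'rV[R]_d) : a *: vcons t y = vcons
    (a * t) (a *: y).
Proof. by apply: vconsP => [|i]; rewrite mxE ?vcons0 ?vconsS// mxE. Qed.

Lemma vcons_split (R : realType) d (v : 'rV[R]_d.+1) : exists t y, v = vcons t y.
Proof.
exists (v ord0 ord0), (\row_i v ord0 (lift ord0 i)).
by apply: vconsP => [|i]; rewrite ?vcons0 ?vconsS// mxE.
Qed.

Lemma sq_vcons (R : realType) d (t : R) (y : 'rV[R]_d) : sq (vcons t y) = t ^+ 2
    + sq y.
Proof.
rewrite /sq big_ord_recl vcons0; congr (_ + _).
by apply: eq_bigr => i _; rewrite vconsS.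
Qed.

(** The topology of row vectors comes from the max norm, so balls are controlled one coordinate at a
    time; [0 < e] covers the base value 0 of the maximum. *)
Lemma normv_lt (R : realType) d (v : 'rV[R]_d) (e : R) : 0 < e ->
  (forall i, `|v ord0 i| < e) -> `|v| < e.
Proof.
move=> e0 h; rewrite [ltLHS]/Num.norm/= mx_normrE; apply/bigmax_ltP; split=> //.
by move=> [i j] _ /=; rewrite (ord1 i).
Qed.

Lemma cvg_vec (R : realType) (T : Type) (F : set_system T) {FF : Filter F} (d :
    nat) (f : T -> 'rV[R]_d)
    (l : 'rV[R]_d) : (forall i, f x ord0 i @[x --> F] --> l ord0 i) ->
  f x @[x --> F] --> l.
Proof.
move=> h; apply/cvgrPdist_lt => e e0.
have : \forall x \near F, forall i, `|l ord0 i - f x ord0 i| < e.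
  apply: filter_forall => i; exact: (cvgrPdist_lt _ _).1 (h i) e e0.
by apply: filterS => x hx; apply: normv_lt => // i; rewrite !mxE.
Qed.

Lemma vcons_continuous_l (R : realType) d (y : 'rV[R]_d) : continuous (fun t =>
    vcons t y).
Proof.
move=> t; apply: cvg_vec => i.
case: (unliftP ord0 i) => [j|] ->.
- under eq_fun do rewrite vconsS; rewrite vconsS; exact: cvg_cst.
- under eq_fun do rewrite vcons0; rewrite vcons0; exact: cvg_id.
Qed.

Lemma vcons_continuous_r (R : realType) d (t : R) : continuous (fun y : 'rV[R]_d
    => vcons t y).
Proof.
move=> y; apply: (@cvg_vec _ _ (nbhs y)) => i.
case: (unliftP ord0 i) => [j|] ->.
- under eq_fun do rewrite vconsS; rewrite vconsS; exact: coord_continuous.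
- under eq_fun do rewrite vcons0; rewrite vcons0; exact: cvg_cst.
Qed.

Lemma cvg_sum_ord (R : realType) (T : Type) (F : set_system T) {FF : Filter F}
    n (f : 'I_n -> T -> R) (l : 'I_n -> R) :
  (forall i, f i x @[x --> F] --> l i) ->
  \sum_(i < n) f i x @[x --> F] --> \sum_(i < n) l i.
Proof.
elim: n f l => [|n IH] f l h.
  by rewrite big_ord0; under eq_fun do rewrite big_ord0; exact: cvg_cst.
rewrite big_ord_recr; under eq_fun do rewrite big_ord_recr.
by apply: cvgD; [exact: IH|exact: h].
Qed.

Lemma sq_continuous (R : realType) d : continuous (@sq R d).
Proof.
move=> y; apply: (@cvg_sum_ord _ _ (nbhs y)) => i.
by apply: (cvg_comp (fun y : 'rV[R]_d => y ord0 i) (fun x => x ^+ 2)); [exact: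
  coord_continuous|exact: sqr_continuous].
Qed.

Lemma sq_coord (R : realType) d (y : 'rV[R]_d) i : y ord0 i ^+ 2 <= sq y.
Proof.
by rewrite /sq (bigD1 i)//= lerDl; apply: sumr_ge0 => j _; exact: sqr_ge0.
Qed.

(** * Iterated integrals of functions with Gaussian decay *)

(** The constants are explicit parameters, so that a whole sequence can share a single majorant for
    dominated convergence. *)
Definition gauss_dom1 (R : realType) (g : R -> R) (c C : R) :=
  continuous g /\ forall t, `|g t| <= C * expR (- (c * t ^+ 2)).

(** Up to the factor [normal_peak s] this is the centred normal density of variance
    [s ^+ 2 = 1 / (2c)]. *)
Lemma integrable_gauss (R : realType) (c : R) : 0 < c ->
  (@lebesgue_measure R).-integrable setT
    (EFin \o (fun t : R => expR (- (c * t ^+ 2)))).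
Proof.
move=> c0; pose s := Num.sqrt (c *+ 2)^-1.
have c20 : 0 < c *+ 2 by rewrite mulrn_wgt0.
have s0 : s != 0 by rewrite gt_eqF// sqrtr_gt0 invr_gt0.
have s2 : s ^+ 2 = (c *+ 2)^-1 by rewrite sqr_sqrtr// invr_ge0 ltW.
have p0 : normal_peak s != 0 by rewrite gt_eqF// normal_peak_gt0.
have -> : EFin \o (fun t : R => expR (- (c * t ^+ 2))) =
    (fun t => ((normal_peak s)^-1)%:E * (normal_pdf 0 s t)%:E)%E.
  apply/funext => t; rewrite -EFinM /= normal_pdfE// (mulrA _^-1) mulVf// mul1r.
  rewrite /normal_fun subr0 s2; congr ((expR _)%:E).
  by field; rewrite gt_eqF.
by apply: integrableZl => //; exact: integrable_normal_pdf.
Qed.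

Lemma gauss_dom1_integrable (R : realType) (g : R -> R) (c C : R) : 0 < c ->
  gauss_dom1 g c C -> (@lebesgue_measure R).-integrable setT (EFin \o g).
Proof.
move=> c0 [cg dg].
apply: (@le_integrable _ _ _ (@lebesgue_measure R) setT measurableT _
  (fun t => C%:E * (expR (- (c * t ^+ 2)))%:E)%E).
- by apply/measurable_EFinP; exact: continuous_measurable_fun.
- move=> t _ /=; rewrite lee_fin (le_trans (dg t))//.
  exact: ler_norm.
- by apply: integrableZl => //; exact: integrable_gauss.
Qed.

Definition gauss_dom (R : realType) d (g : 'rV[R]_d -> R) (c C : R) :=
  continuous g /\ forall y, `|g y| <= C * expR (- (c * sq y)).

(** The factor that the constant of a Gaussian majorant picks up at each partial integration. *)
Definition gaussK (R : realType) (c : R) : R :=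
  \int[@lebesgue_measure R]_t expR (- (c * t ^+ 2)).

Lemma gaussK_ge0 (R : realType) (c : R) : 0 <= gaussK c.
Proof. by apply: Rintegral_ge0 => t _; exact: expR_ge0. Qed.

Lemma gauss_dom_C_ge0 (R : realType) d (g : 'rV[R]_d -> R) c C : gauss_dom g c C
    -> 0 <= C.
Proof.
move=> [_ /(_ 0)]; rewrite sq0 mulr0 oppr0 expR0 mulr1.
exact: le_trans.
Qed.

(** The Gaussian majorant factors over coordinates; the decay in [t] stays in the constant, ready
    for the integration over [t]. *)
Lemma gauss_dom_vcons (R : realType) d (g : 'rV[R]_d.+1 -> R) c C t : gauss_dom g
    c C ->
  gauss_dom (fun y => g (vcons t y)) c (C * expR (- (c * t ^+ 2))).
Proof.
move=> [cg dg]; split.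
  move=> y; apply: (cvg_comp (fun y => vcons t y) g); last exact: cg.
  exact: vcons_continuous_r.
move=> y; rewrite (le_trans (dg _))// sq_vcons -mulrA -expRD.
by rewrite mulrDr opprD.
Qed.

Lemma gauss_dom1_bound (R : realType) (g : R -> R) c C : 0 < c -> gauss_dom1 g c C ->
  `|\int[@lebesgue_measure R]_t g t| <= C * gaussK c.
Proof.
move=> c0 gg; have ig := gauss_dom1_integrable c0 gg.
apply: le_trans (le_normr_Rintegral measurableT ig) _.
rewrite /gaussK -RintegralZl//; last exact: integrable_gauss.
apply: le_Rintegral => //.
- exact: (@integrable_abse _ _ _ _ setT _ ig).
- have := integrableZl measurableT C (integrable_gauss c0).
  by apply: eq_integrable => // t _; rewrite EFinM.
- by move=> t _; exact: gg.2.
Qed.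

Lemma gauss_dom1_cvg (R : realType) (gn : nat -> R -> R) (g : R -> R) c C : 0 < c ->
  (forall n, gauss_dom1 (gn n) c C) -> gauss_dom1 g c C ->
  (forall t, gn n t @[n --> \oo] --> g t) ->
  \int[@lebesgue_measure R]_t gn n t @[n --> \oo] -->
  \int[@lebesgue_measure R]_t g t.
Proof.
move=> c0 hn h hc.
have ig := gauss_dom1_integrable c0 h.
apply: (@fine_cvg _ _ _ _ _ (\int[@lebesgue_measure R]_t g t)).
rewrite fineK; last exact: integrable_fin_num.
apply: (@dominated_cvg _ _ _ (@lebesgue_measure R) setT measurableT
  (fun n t => (gn n t)%:E) (fun t => (g t)%:E)
  (fun t => (C * expR (- (c * t ^+ 2)))%:E)).
- move=> n; apply/measurable_EFinP; apply: continuous_measurable_fun.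
  exact: (hn n).1.
- by move=> t _; apply: cvg_EFin; [exact: nearW|exact: hc].
- by [].
- have := integrableZl measurableT C (integrable_gauss c0).
  by apply: eq_integrable => // t _; rewrite EFinM.
- by move=> n t _; rewrite lee_fin; exact: (hn n).2.
Qed.

(** Inductive step with the two properties of dimension d as hypotheses: the bound gives decay of
    the partial integral in the remaining variable, the convergence gives its continuity. *)
Lemma RintRd_slice (R : realType) d :
  (forall (g : 'rV[R]_d -> R) c C, 0 < c -> gauss_dom g c C ->
    `|RintRd g| <= C * gaussK c ^+ d) ->
  (forall (gn : nat -> 'rV[R]_d -> R) g c C, 0 < c ->
    (forall n, gauss_dom (gn n) c C) -> gauss_dom g c C ->
    (forall y, gn n y @[n --> \oo] --> g y) ->
    RintRd (gn n) @[n --> \oo] --> RintRd g) ->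
  forall (g : 'rV[R]_d.+1 -> R) c C, 0 < c -> gauss_dom g c C ->
    gauss_dom1 (fun t => RintRd (fun y => g (vcons t y))) c (C * gaussK c ^+ d).
Proof.
move=> H1 H2 g c C c0 gg; split; last first.
  move=> t; have := H1 _ _ _ c0 (gauss_dom_vcons t gg).
  by rewrite mulrAC.
move=> t; apply/(@cvg_nbhsP _ R^o) => u ut.
have C0 := gauss_dom_C_ge0 gg.
apply: (H2 _ _ c C) => //.
(* The factor [expR (- (c * u n ^+ 2))] is bounded by 1, so that one constant [C] serves the whole
   sequence. *)
- move=> n; have [? hd] := gauss_dom_vcons (u n) gg; split=> // y.
  rewrite (le_trans (hd y))// ler_wpM2r ?expR_ge0// ler_piMr//.
  by rewrite -[leRHS]expR0 ler_expR oppr_le0 mulr_ge0 ?sqr_ge0// ltW.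
- have [? hd] := gauss_dom_vcons t gg; split=> // y.
  rewrite (le_trans (hd y))// ler_wpM2r ?expR_ge0// ler_piMr//.
  by rewrite -[leRHS]expR0 ler_expR oppr_le0 mulr_ge0 ?sqr_ge0// ltW.
- move=> y; apply: (@cvg_comp _ _ _ u (fun s => g (vcons s y)) \oo (nbhs t)) => //.
  apply: (cvg_comp (fun s => vcons s y) g); last exact: gg.1.
  exact: vcons_continuous_l.
Qed.

(** Both claims go through one induction: the bound in dimension d+1 needs the slices to be
    continuous, which is the convergence claim in dimension d. *)
Lemma RintRd_bound_cvg (R : realType) d :
  (forall (g : 'rV[R]_d -> R) c C, 0 < c -> gauss_dom g c C ->
    `|RintRd g| <= C * gaussK c ^+ d) /\
  (forall (gn : nat -> 'rV[R]_d -> R) g c C, 0 < c ->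
    (forall n, gauss_dom (gn n) c C) -> gauss_dom g c C ->
    (forall y, gn n y @[n --> \oo] --> g y) ->
    RintRd (gn n) @[n --> \oo] --> RintRd g).
Proof.
elim: d => [|d [IH1 IH2]]; split.
- move=> g c C c0 [_ /(_ 0)] /=.
  by rewrite sq0 mulr0 oppr0 expR0 expr0.
- by move=> gn g c C c0 _ _ /(_ 0).
- move=> g c C c0 gg /=.
  have := gauss_dom1_bound c0 (RintRd_slice IH1 IH2 c0 gg).
  by rewrite -mulrA -exprSr.
- move=> gn g c C c0 hn h hc /=.
  apply: (gauss_dom1_cvg c0 (fun n => RintRd_slice IH1 IH2 c0 (hn n))
    (RintRd_slice IH1 IH2 c0 h)) => t.
  apply: (IH2 _ _ _ _ c0 (fun n => gauss_dom_vcons t (hn n)) (gauss_dom_vcons t h)).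
  by move=> y; exact: hc.
Qed.

Lemma gauss_dom_slice (R : realType) d (g : 'rV[R]_d.+1 -> R) c C : 0 < c ->
  gauss_dom g c C ->
  gauss_dom1 (fun t => RintRd (fun y => g (vcons t y))) c (C * gaussK c ^+ d).
Proof. by have [h1 h2] := RintRd_bound_cvg R d; exact: RintRd_slice. Qed.

Lemma continuous_fD (R : realType) (T : topologicalType) (f g : T -> R) :
  continuous f -> continuous g -> continuous (fun x => f x + g x).
Proof.
by move=> cf cg x; apply: (@cvgD _ _ _ (nbhs x) _ f g); [exact: cf|exact: cg].
Qed.

Lemma continuous_fM (R : realType) (T : topologicalType) (f g : T -> R) :
  continuous f -> continuous g -> continuous (fun x => f x * g x).
Proof.
by move=> cf cg x; apply: (@cvgM _ _ (nbhs x) _ f g); [exact: cf|exact: cg].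
Qed.

Lemma continuous_fN (R : realType) (T : topologicalType) (f : T -> R) :
  continuous f -> continuous (fun x => - f x).
Proof. by move=> cf x; apply: (@cvgN _ _ _ (nbhs x) _ f); exact: cf. Qed.

Lemma continuous_cstf (R : realType) (T : topologicalType) (a : R) :
  continuous (fun _ : T => a).
Proof. by move=> x; exact: cvg_cst. Qed.

Lemma continuous_compf (T U : topologicalType) (V : topologicalType) (f : T -> U)
    (g : U -> V) :
  continuous f -> continuous g -> continuous (fun x => g (f x)).
Proof. by move=> cf cg x; apply: (cvg_comp f g (cf x)); exact: cg. Qed.

Lemma gauss_domW (R : realType) d (g : 'rV[R]_d -> R) c c' C C' :
  gauss_dom g c C -> c' <= c -> C <= C' -> gauss_dom g c' C'.
Proof.
move=> gg cc CC; split; first exact: gg.1.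
move=> y; rewrite (le_trans (gg.2 y))// ler_pM ?expR_ge0 ?(gauss_dom_C_ge0 gg)//.
by rewrite ler_expR lerN2 ler_wpM2r ?sq_ge0.
Qed.

(** Hiding the constants yields a class closed under sums, multiples, slices and affine
    substitutions. *)
Definition gauss_decay (R : realType) d (g : 'rV[R]_d -> R) :=
  exists c C, 0 < c /\ gauss_dom g c C.

Lemma gauss_decay_common (R : realType) d (f g : 'rV[R]_d -> R) : gauss_decay f
    -> gauss_decay g ->
  exists c C, [/\ 0 < c, gauss_dom f c C & gauss_dom g c C].
Proof.
move=> [c [C [c0 gf]]] [c' [C' [c0' gg]]].
exists (Num.min c c'), (Num.max C C'); split.
- by rewrite lt_min c0.
- by apply: gauss_domW gf _ _; rewrite ?ge_min ?le_max lexx.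
- by apply: gauss_domW gg _ _; rewrite ?ge_min ?le_max lexx ?orbT.
Qed.

Lemma gauss_decayD (R : realType) d (f g : 'rV[R]_d -> R) : gauss_decay f ->
    gauss_decay g ->
  gauss_decay (fun y => f y + g y).
Proof.
move=> hf hg; have [c [C [c0 gf gg]]] := gauss_decay_common hf hg.
exists c, (C + C); split=> //; split.
  by apply: continuous_fD; [exact: gf.1|exact: gg.1].
by move=> y; rewrite (le_trans (ler_normD _ _))// mulrDl lerD ?gf.2 ?gg.2.
Qed.

Lemma gauss_decayZ (R : realType) d (a : R) (f : 'rV[R]_d -> R) : gauss_decay f ->
  gauss_decay (fun y => a * f y).
Proof.
move=> [c [C [c0 gf]]].
exists c, (`|a| * C); split=> //; split.
  by apply: continuous_fM; [exact: continuous_cstf|exact: gf.1].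
by move=> y; rewrite normrM -mulrA ler_wpM2l// gf.2.
Qed.

Lemma gauss_decay_slice (R : realType) d (g : 'rV[R]_d.+1 -> R) t : gauss_decay g ->
  gauss_decay (fun y => g (vcons t y)).
Proof.
by move=> [c [C [c0 gg]]]; exists c; eexists; split=> //; exact: gauss_dom_vcons gg.
Qed.

Lemma gauss_decay_integrable (R : realType) d (g : 'rV[R]_d.+1 -> R) :
    gauss_decay g ->
  (@lebesgue_measure R).-integrable setT
    (EFin \o (fun t => RintRd (fun y => g (vcons t y)))).
Proof.
move=> [c [C [c0 gg]]]; apply: (gauss_dom1_integrable c0); exact: gauss_dom_slice gg.
Qed.

Lemma RintRdD (R : realType) d (f g : 'rV[R]_d -> R) : gauss_decay f ->
    gauss_decay g ->
  RintRd (fun y => f y + g y) = RintRd f + RintRd g.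
Proof.
elim: d f g => [//|d IH] f g hf hg /=.
rewrite -RintegralD//; [|exact: gauss_decay_integrable|exact: gauss_decay_integrable].
by apply: eq_Rintegral => t _; rewrite IH//; exact: gauss_decay_slice.
Qed.

Lemma RintRdZ (R : realType) d (a : R) (f : 'rV[R]_d -> R) : gauss_decay f ->
  RintRd (fun y => a * f y) = a * RintRd f.
Proof.
elim: d f => [//|d IH] f hf /=.
rewrite -RintegralZl//; last exact: gauss_decay_integrable.
by apply: eq_Rintegral => t _; rewrite IH//; exact: gauss_decay_slice.
Qed.

Lemma eq_RintRd (R : realType) d (f g : 'rV[R]_d -> R) : f =1 g ->
  RintRd f = RintRd g.
Proof. by move=> /funext ->. Qed.

Lemma RintRd_le (R : realType) d (f g : 'rV[R]_d -> R) : gauss_decay f ->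
    gauss_decay g ->
  (forall y, f y <= g y) -> RintRd f <= RintRd g.
Proof.
elim: d f g => [|d IH] f g hf hg h /=; first exact: h.
apply: le_Rintegral => //; [exact: gauss_decay_integrable|exact:
  gauss_decay_integrable|].
by move=> t _; apply: IH => //; exact: gauss_decay_slice.
Qed.

Lemma RintRd_ge0 (R : realType) d (f : 'rV[R]_d -> R) :
  (forall y, 0 <= f y) -> 0 <= RintRd f.
Proof.
elim: d f => [|d IH] f h /=; first exact: h.
by apply: Rintegral_ge0 => t _; exact: IH.
Qed.

Lemma gauss_dom1_gt0 (R : realType) (g : R -> R) c C : 0 < c -> gauss_dom1 g c C ->
  (forall t, 0 < g t) -> 0 < \int[@lebesgue_measure R]_t g t.
Proof.
move=> c0 gg g0; have ig := gauss_dom1_integrable c0 gg.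
(* The minimum of [g] on [0, 1] is positive and bounds the integral from below. *)
have [|m _ hm] := @EVT_min R g 0 1 ler01.
  by apply: continuous_subspaceT; exact: gg.1.
rewrite /Rintegral fine_gt0//; apply/andP; split; last first.
  by rewrite -ge0_fin_numE ?integral_ge0// => [|t _]; [exact:
    integrable_fin_num|rewrite lee_fin ltW].
have h1 : (\int[@lebesgue_measure R]_(t in `[0%R, 1%R]) (g t)%:E <=
    \int[@lebesgue_measure R]_t (g t)%:E)%E.
  apply: ge0_subset_integral => //; first by case/integrableP: ig.
  by move=> t _; rewrite lee_fin ltW.
apply: lt_le_trans h1.
have h2 : (0 < \int[@lebesgue_measure R]_(t in `[0%R, 1%R]) (g m)%:E)%E.
  rewrite integral_cst//= lebesgue_measure_itv/= lte_fin ltr01.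
  by rewrite oppr0 adde0 mule1 lte_fin.
apply: (lt_le_trans h2); apply: ge0_le_integral => //.
- by move=> t _; rewrite lee_fin ltW.
- by apply/measurable_funTS; case/integrableP: ig.
Qed.

Lemma RintRd_gt0 (R : realType) d (f : 'rV[R]_d -> R) : gauss_decay f ->
  (forall y, 0 < f y) -> 0 < RintRd f.
Proof.
elim: d f => [|d IH] f hf h /=; first exact: h.
have [c [C [c0 gf]]] := hf.
apply: (gauss_dom1_gt0 c0 (gauss_dom_slice c0 gf)) => t.
by apply: IH => //; exact: gauss_decay_slice.
Qed.

(** * Affine changes of variables, and comparison with the extended-real integral *)

Lemma gauss_dom1_affine (R : realType) (g : R -> R) (c C a b : R) : 0 < c ->
    gauss_dom1 g c C ->
  (forall t, 0 <= g t) -> 0 < b ->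
  \int[@lebesgue_measure R]_t g (a + b * t) =
  b^-1 * \int[@lebesgue_measure R]_t g t.
Proof.
move=> c0 gg g0 b0; have ig := gauss_dom1_integrable c0 gg.
have df (x : R) : is_derive x (1 : R) (fun t : R => a + b * t) b.
  by apply: is_derive_eq; rewrite add0r /GRing.scale /= mulr1 mul1r.
have dE : derive1 (fun t : R => a + b * t) = cst b.
  by apply/funext => x; rewrite derive1E derive_val.
have Fy : (fun t : R => a + b * t) x @[x --> +oo] --> +oo.
  apply/cvgryPge => A.
  have := nbhs_pinfty_ge (num_real (b^-1 * (A - a))); apply: filterS => t.
  by rewrite ler_pdivrMl// lerBlDl.
have FNy : (fun t : R => a + b * t) x @[x --> -oo] --> -oo.
  apply/cvgrNyPle => A.
  have := nbhs_ninfty_le (num_real (b^-1 * (A - a))); apply: filterS => t.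
  by rewrite ler_pdivlMl// lerBrDl.
have := @increasing_ge0_integration_by_substitutionT R (fun t => a + b * t) g.
rewrite dE => /(_ _ _ _ _ _ FNy Fy gg.1 g0) H.
rewrite /Rintegral H; last first.
- by move=> x; exact: ex_derive.
- exact: is_cvg_cst.
- exact: is_cvg_cst.
- by move=> x; exact: cvg_cst.
- by move=> x y xy; rewrite ltrD2l ltr_pM2l.
rewrite -[b^-1]/(fine (b^-1)%:E).
rewrite -fineM//; last first.
  rewrite -H; first exact: integrable_fin_num.
  + by move=> x y xy; rewrite ltrD2l ltr_pM2l.
  + by move=> x; exact: cvg_cst.
  + exact: is_cvg_cst.
  + exact: is_cvg_cst.
  + by move=> x; exact: ex_derive.
rewrite -ge0_integralZl//.
- congr fine; apply: eq_integral => t _ /=.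
  rewrite -EFinM; congr EFin.
  by rewrite -[RHS]/(b^-1 * (g (a + b * t) * b)) mulrCA mulVf ?mulr1// gt_eqF.
- apply/measurable_EFinP; apply: continuous_measurable_fun.
  apply: continuous_fM; last exact: continuous_cstf.
  apply: (@continuous_compf _ _ _ (fun t : R => a + b * t) g _ gg.1).
  by apply: continuous_fD; [exact: continuous_cstf|apply: continuous_fM; [exact:
    continuous_cstf|move=> ?; exact: cvg_id]].
- by move=> t _; rewrite lee_fin; apply: mulr_ge0; [exact: g0|exact: ltW].
- by rewrite lee_fin invr_ge0 ltW.
Qed.

(** Each coordinate contributes one factor [b^-1]; the one-dimensional substitution is the one for
    nonnegative integrands. *)
Lemma RintRd_affine (R : realType) d (g : 'rV[R]_d -> R) (a : 'rV[R]_d) (b : R) :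
    gauss_decay g ->
  (forall y, 0 <= g y) -> 0 < b ->
  RintRd (fun y => g (a + b *: y)) = b ^- d * RintRd g.
Proof.
elim: d g a => [|d IH] g a hg g0 b0.
  by rewrite expr0 invr1 mul1r /=; congr g; apply/rowP => -[].
have [a0 [a' ->]] := vcons_split a => /=.
have [c [C [c0 gg]]] := hg.
have gs := gauss_dom_slice c0 gg.
rewrite exprSr invfM -mulrA -(@gauss_dom1_affine _ _ _ _ a0 _ c0 gs)//; last first.
  by move=> t; exact: RintRd_ge0.
rewrite -RintegralZl//; last first.
  (* The constants come from (a0 + b t)^2 + a0^2 - b^2 t^2 / 2 = (2 a0 + b t)^2 / 2, which is
     nonnegative. *)
  apply: (@gauss_dom1_integrable _ _ (c * b ^+ 2 / 2)
     (C * gaussK c ^+ d * expR (c * a0 ^+ 2))).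
    by rewrite divr_gt0// mulr_gt0// exprn_gt0.
  split.
    apply: (@continuous_compf _ _ _ (fun t : R => a0 + b * t) _ _ gs.1).
    by apply: continuous_fD; [exact: continuous_cstf|apply: continuous_fM;
      [exact: continuous_cstf|move=> ?; exact: cvg_id]].
  move=> t; rewrite (le_trans (gs.2 _))// -!mulrA -expRD.
  rewrite ler_wpM2l ?(gauss_dom_C_ge0 gg)// ler_wpM2l ?exprn_ge0 ?gaussK_ge0//.
  rewrite ler_expR -subr_ge0.
  rewrite [leRHS](_ : _ = c * (2 * a0 + b * t) ^+ 2 / 2); last by field.
  by rewrite divr_ge0// mulr_ge0 ?sqr_ge0// ltW.
apply: eq_Rintegral => t _; rewrite -(IH _ a')//; last exact: gauss_decay_slice.
by apply: eq_RintRd => y; rewrite vconsZ vconsD.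
Qed.

Lemma eintRd_ge0 (R : realType) d (f : 'rV[R]_d -> \bar R) :
  (forall y, 0 <= f y)%E -> (0 <= eintRd f)%E.
Proof.
elim: d f => [|d IH] f h /=; first exact: h.
by apply: integral_ge0 => t _; exact: IH.
Qed.

(** The slices come without measurability, so the comparison is made on the simple functions below
    each integrand, whose integrals have the integral as supremum. *)
Lemma eintRd_le (R : realType) d (f g : 'rV[R]_d -> \bar R) :
  (forall y, 0 <= f y)%E -> (forall y, f y <= g y)%E -> (eintRd f <= eintRd g)%E.
Proof.
elim: d f g => [|d IH] f g f0 fg /=; first exact: fg.
have g0 y : (0 <= g y)%E by exact: le_trans (fg y).
rewrite !ge0_integralTE; [|by move=> t; exact: eintRd_ge0..].
apply: le_ereal_sup => _ [h hf <-]; exists h => // t.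
by apply: le_trans (hf t) _; exact: IH.
Qed.

Lemma eintRd_RintRd (R : realType) d (f : 'rV[R]_d -> R) : gauss_decay f ->
  (forall y, 0 <= f y) -> eintRd (fun y => (f y)%:E) = (RintRd f)%:E.
Proof.
elim: d f => [//|d IH] f hf f0 /=.
rewrite /Rintegral fineK; last exact: integrable_fin_num (gauss_decay_integrable hf).
by apply: eq_integral => t _; rewrite IH//; exact: gauss_decay_slice.
Qed.

(** * The Prekopa-Leindler inequality at the midpoint *)

Lemma is_derive_continuous (R : realType) (K : R -> R) (x k : R) :
  is_derive x 1 K k -> {for x, continuous K}.
Proof.
by move=> h; apply/differentiable_continuous/derivable1_diffP; exact: ex_derive.
Qed.

Lemma is_derive_incr (R : realType) (K k : R -> R) :
  (forall x : R, is_derive x 1 K (k x)) -> (forall x, 0 < k x) ->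
  forall x y, x < y -> K x < K y.
Proof.
move=> dK k0 x y xy.
have [|z _ e] := @MVT R K k x y xy.
- by apply: continuous_subspaceT => z; exact: is_derive_continuous (dK z).
- by rewrite -subr_gt0 e mulr_gt0// subr_gt0.
Qed.

Lemma is_derive_ndecr (R : realType) (K k : R -> R) :
  (forall x : R, is_derive x 1 K (k x)) -> (forall x, 0 <= k x) ->
  forall x y, x < y -> K x <= K y.
Proof.
move=> dK k0 x y xy.
have [|z _ e] := @MVT R K k x y xy.
- by apply: continuous_subspaceT => z; exact: is_derive_continuous (dK z).
- by rewrite -subr_ge0 e mulr_ge0// subr_ge0 ltW.
Qed.

(** The unnormalized distribution function of the density [f]. *)
Definition lowint (R : realType) (f : R -> R) (x : R) : R :=
  \int[@lebesgue_measure R]_(t in `]-oo, x]) f t.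

Lemma lowint_derive (R : realType) (f : R -> R) (c C x : R) : 0 < c -> gauss_dom1
    f c C ->
  is_derive x (1 : R) (lowint f) (f x).
Proof.
move=> c0 gf; have intf := gauss_dom1_integrable c0 gf.
have [||||d1 d2] := @continuous_FTC1 R f -oo%O x (x + 1).
- by rewrite ltrDl.
- by apply: integrableS intf.
- by rewrite ltNyr.
- exact: gf.1.
by split; [exact: d1|rewrite -derive1E; exact: d2].
Qed.

(** Dominated convergence for indicators that are eventually constant at each point; it yields the
    limits of [lowint] at both ends of the line. *)
Lemma Rintegral_cvg_set (R : realType) (f : R -> R) (c C : R) (A : nat -> set R)
    (B : set R) : 0 < c -> gauss_dom1 f c C ->
  (forall n, measurable (A n)) -> 
  (forall t, \forall n \near \oo, (t \in A n) = (t \in B)) ->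
  \int[@lebesgue_measure R]_(t in A n) f t @[n --> \oo] -->
  \int[@lebesgue_measure R]_(t in B) f t.
Proof.
move=> c0 gf mA AB; have intf := gauss_dom1_integrable c0 gf.
rewrite Rintegral_mkcond; under eq_fun do rewrite Rintegral_mkcond.
have H t : EFin ((f \_ (A n)) t) @[n --> \oo] --> EFin ((f \_ B) t).
  apply: cvg_near_cst; have := AB t; apply: filterS => n e.
  by rewrite !patchE e.
have mn n : measurable_fun [set: R] (fun t => ((f \_ (A n)) t)%:E).
  apply/measurable_EFinP; apply: (measurable_restrictT f (mA n)).1.
  apply: (@measurable_funS _ _ _ _ [set: R]) => //.
  exact: continuous_measurable_fun gf.1.
have mB : measurable_fun [set: R] (fun t => ((f \_ B) t)%:E).
  by apply: (emeasurable_fun_cvg (fun n t => ((f \_ (A n)) t)%:E)).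
have ig : (@lebesgue_measure R).-integrable setT
    (fun t : R => (C * expR (- (c * t ^+ 2)))%:E).
  have := integrableZl measurableT C (integrable_gauss c0).
  by apply: eq_integrable => // t _; rewrite EFinM.
have C0 t : 0 <= C * expR (- (c * t ^+ 2)) by exact: le_trans (gf.2 t).
have bd (D : set R) t : `|(f \_ D) t| <= C * expR (- (c * t ^+ 2)).
  by rewrite patchE; case: ifP => _; [exact: gf.2|rewrite normr0].
have iB : (@lebesgue_measure R).-integrable setT (fun t : R => ((f \_ B) t)%:E).
  apply: le_integrable ig => // t _ /=.
  by rewrite lee_fin (le_trans (bd _ _))// ler_norm.
apply: (@fine_cvg _ _ _ _ _ (\int[@lebesgue_measure R]_t ((f \_ B) t))).
rewrite fineK; last exact: integrable_fin_num.
apply: (@dominated_cvg _ _ _ (@lebesgue_measure R) setT measurableT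
  (fun n t => ((f \_ (A n)) t)%:E) (fun t => ((f \_ B) t)%:E)
  (fun t => (C * expR (- (c * t ^+ 2)))%:E)) => //.
by move=> n t _; rewrite lee_fin; exact: bd.
Qed.

Lemma near_natP (R : realType) (x : R) : \forall n \near \oo, x <= n%:R.
Proof.
by near=> n; rewrite ltW//; near: n; exact: nbhs_infty_gtr.
Unshelve. all: by end_near. Qed.

Lemma lowint_cvg1 (R : realType) (f : R -> R) (c C : R) : 0 < c -> gauss_dom1 f c C ->
  lowint f n%:R @[n --> \oo] --> \int[@lebesgue_measure R]_t f t.
Proof.
move=> c0 gf; apply: (Rintegral_cvg_set c0 gf) => // t.
have := near_natP t; apply: filterS => n tn.
by rewrite in_setT; apply/mem_set; rewrite /= in_itv/= tn.
Qed.

Lemma lowint_cvg0 (R : realType) (f : R -> R) (c C : R) : 0 < c -> gauss_dom1 f c C ->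
  lowint f (- n%:R) @[n --> \oo] --> (0 : R).
Proof.
move=> c0 gf; rewrite -(Rintegral_set0 (@lebesgue_measure R) f).
apply: (Rintegral_cvg_set c0 gf) => // t.
have := near_natP (1 - t); apply: filterS => n tn.
rewrite in_set0; apply/negbTE/negP => /set_mem; rewrite /= in_itv/=.
by apply/negP; rewrite -ltNge; lra.
Qed.

Lemma lowint_le (R : realType) (f : R -> R) (c C x : R) : 0 < c -> gauss_dom1 f c C ->
  (forall t, 0 < f t) -> lowint f x <= \int[@lebesgue_measure R]_t f t.
Proof.
move=> c0 gf f0; have h := lowint_cvg1 c0 gf.
apply: (cvgr_to_ge h); have := near_natP (x + 1); apply: filterS => n xn.
by apply/ltW/(is_derive_incr (fun x => lowint_derive x c0 gf) f0); lra.
Qed.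

Lemma lowint_ge0 (R : realType) (f : R -> R) (x : R) : (forall t, 0 < f t) ->
  0 <= lowint f x.
Proof. by move=> f0; apply: Rintegral_ge0 => t _; exact: ltW. Qed.

Lemma lowint_onto (R : realType) (f : R -> R) (c C v : R) : 0 < c -> gauss_dom1 f
    c C ->
  0 < v -> v < \int[@lebesgue_measure R]_t f t -> exists x, lowint f x = v.
Proof.
move=> c0 gf v0 v1.
have [n [hn0 hn1]] : exists n, lowint f (- n%:R) <= v /\ v <= lowint f n%:R.
  have h0 : \forall n \near \oo, lowint f (- n%:R) <= v.
    exact: cvgr_le (lowint_cvg0 c0 gf) _ v0.
  have h1 : \forall n \near \oo, v <= lowint f n%:R.
    exact: cvgr_ge (lowint_cvg1 c0 gf) _ v1.
  by have [n [? ?]] := filter_ex (filterI h0 h1); exists n.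
have [|||x _ xv] := @IVT R (lowint f) (- n%:R) n%:R v; last by exists x.
- by rewrite lerNl (le_trans _ (ler0n _ _))// oppr_le0.
- by apply: continuous_subspaceT => z; exact: is_derive_continuous (lowint_derive
  z c0 gf).
- by rewrite ge_min hn0 le_max hn1 orbT.
Qed.

(* Transport: T pushes the normalized mass of f onto that of g. Along the
   midpoints (x + T x) / 2 the mass of h grows at rate at least s * f x, by
   AM-GM applied to (1 + T') / 2 with T' = s^2 f / g(T). *)
Lemma prekopa_1d (R : realType) (f g h : R -> R) (c C : R) : 0 < c ->
  gauss_dom1 f c C -> gauss_dom1 g c C -> gauss_dom1 h c C ->
  (forall t, 0 < f t) -> (forall t, 0 < g t) -> (forall t, 0 < h t) ->
  (forall x y, f x * g y <= h (2^-1 * (x + y)) ^+ 2) ->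
  (\int[@lebesgue_measure R]_t f t) * (\int[@lebesgue_measure R]_t g t) <=
  (\int[@lebesgue_measure R]_t h t) ^+ 2.
Proof.
move=> c0 gf gg gh f0 g0 h0 fgh.
set a := \int[@lebesgue_measure R]_t f t.
set b := \int[@lebesgue_measure R]_t g t.
set m := \int[@lebesgue_measure R]_t h t.
have a0 : 0 < a := gauss_dom1_gt0 c0 gf f0.
have b0 : 0 < b := gauss_dom1_gt0 c0 gg g0.
have m0 : 0 < m := gauss_dom1_gt0 c0 gh h0.
(* With this choice [s ^+ 2 * lowint f] has the total mass [b] of [g], and [s * a] is the geometric
   mean of [a] and [b], so the goal becomes [s * a <= m]. *)
pose s := Num.sqrt (b / a).
have s0 : 0 < s by rewrite sqrtr_gt0 divr_gt0.
have s2 : s ^+ 2 = b / a by rewrite sqr_sqrtr// divr_ge0// ltW.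
have incrF := is_derive_incr (fun x => lowint_derive x c0 gf) f0.
have incrG := is_derive_incr (fun x => lowint_derive x c0 gg) g0.
have exT x : exists y, lowint g y = s ^+ 2 * lowint f x.
  apply: (lowint_onto c0 gg).
    rewrite mulr_gt0 ?exprn_gt0//; apply: le_lt_trans (incrF (x - 1) x _).
      exact: lowint_ge0.
    by rewrite ltrBlDr ltrDl.
  rewrite s2 -/b -[ltRHS](@divfK _ a) ?gt_eqF// ltr_pM2l ?divr_gt0//.
  apply: lt_le_trans (incrF x (x + 1) _) _; first by rewrite ltrDl.
  exact: lowint_le c0 gf f0.
(* The quantile function of [g], by choice; the default 0 is only taken at values that [lowint g]
   does not attain. Strict monotonicity makes it a left inverse. *)
pose Gi (v : R) : R := xget 0 [set y | lowint g y = v].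
have GiK : cancel (lowint g) Gi.
  move=> y; have : lowint g (Gi (lowint g y)) = lowint g y.
    by apply: (@xgetPex _ 0 [set z | lowint g z = lowint g y]); exists y.
  move: (Gi _) => z e; apply/eqP; case: ltgtP => // /incrG; by rewrite e ltxx.
pose T (x : R) : R := Gi (s ^+ 2 * lowint f x).
have TK x : lowint g (T x) = s ^+ 2 * lowint f x.
  by have [y e] := exT x; rewrite /T -e GiK.
have dT x : is_derive x (1 : R) T ((g (T x))^-1 * (s ^+ 2 * f x)).
  have d1 : is_derive (s ^+ 2 * lowint f x) (1 : R) Gi (g (T x))^-1.
    rewrite -TK; apply: is_derive_inverse; last by rewrite gt_eqF.
    - by near=> z; exact: GiK.
    - by near=> z; exact: is_derive_continuous (lowint_derive z c0 gg).
    - exact: lowint_derive c0 gg.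
  have d2 : is_derive x (1 : R) (fun x => s ^+ 2 * lowint f x) (s ^+ 2 * f x).
    by have := is_deriveZ (s ^+ 2) (lowint_derive x c0 gf); exact.
  exact: (@is_derive1_comp _ Gi (fun x => s ^+ 2 * lowint f x) x _ _ d1 d2).
pose M (x : R) : R := 2^-1 * (x + T x).
have dM x : is_derive x (1 : R) M (2^-1 * (1 + (g (T x))^-1 * (s ^+ 2 * f x))).
  by have := is_deriveZ (2^-1) (is_deriveD (is_derive_id x (1 : R)) (dT x)); exact.
pose K (x : R) : R := lowint h (M x) - s * lowint f x.
have dK x : is_derive x (1 : R) K
   (h (M x) * (2^-1 * (1 + (g (T x))^-1 * (s ^+ 2 * f x))) - s * f x).
  have d1 := is_derive1_comp (lowint_derive (M x) c0 gh) (dM x).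
  have d2 := is_deriveZ s (lowint_derive x c0 gf).
  exact: is_deriveB d1 d2.
have K0 x : 0 <= h (M x) * (2^-1 * (1 + (g (T x))^-1 * (s ^+ 2 * f x))) - s * f x.
  rewrite subr_ge0; set q := h (M x); set y := g (T x); set z := f x.
  have q0 : 0 < q := h0 _.
  have y0 : 0 < y := g0 _.
  have z0 : 0 < z := f0 _.
  have zyq : z * y <= q ^+ 2 := fgh _ _.
  rewrite -(@ler_pXn2r _ 2)// ?nnegrE; last 2 first.
  - by rewrite mulr_ge0 ?ltW.
  - rewrite mulr_ge0 ?ltW// mulr_gt0 ?invr_gt0// addr_gt0// mulr_gt0 ?invr_gt0//.
    by rewrite mulr_gt0// exprn_gt0.
  rewrite [leRHS]exprMn; apply: (@le_trans _ _ (z * y *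
    (2^-1 * (1 + y^-1 * (s ^+ 2 * z))) ^+ 2)); last first.
    by rewrite ler_wpM2r// sqr_ge0.
  rewrite -subr_ge0.
  (* AM-GM in squared form: with r = s^2 z / y, the difference ((1 + r) / 2)^2 - r equals ((1 - r) /
     2)^2. *)
  rewrite [leRHS](_ : _ = z * y * (2^-1 * (1 - y^-1 * (s ^+ 2 * z))) ^+ 2).
    by rewrite mulr_ge0 ?sqr_ge0 ?mulr_ge0 ?ltW.
  by field; rewrite gt_eqF.
have sam : s * a <= m.
  (* Monotonicity of [K] between -n and n+1; the upper end is n+1 so that the interval is
     nondegenerate already for n = 0. *)
  have h1 n : s * (lowint f n.+1%:R - lowint f (- n%:R)) <= m.
    have nn : - n%:R < n.+1%:R :> R.
      by rewrite (@le_lt_trans _ _ 0)// oppr_le0.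
    have aux (m' s' u v p q : R) : 0 <= u -> v <= m' ->
      u - s' * p <= v - s' * q -> s' * (q - p) <= m' by clear; lra.
    apply: aux (lowint_ge0 (M (- n%:R)) h0) (lowint_le (M n.+1%:R) c0 gh h0) _.
    by have := is_derive_ndecr dK K0 nn.
  have l1 : s * (lowint f n.+1%:R - lowint f (- n%:R)) @[n --> \oo] --> s * (a - 0).
    apply: cvgM; first exact: cvg_cst.
    apply: cvgB; last exact: lowint_cvg0 c0 gf.
    by rewrite (cvg_shiftS (fun n => lowint f n%:R)); exact: lowint_cvg1 c0 gf.
  by rewrite -[a]subr0; apply: (cvgr_to_le l1); apply: nearW.
have -> : a * b = (s * a) ^+ 2 by rewrite exprMn s2; field; rewrite gt_eqF.
by rewrite ler_pXn2r// nnegrE ?mulr_ge0 ?ltW.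
Unshelve. all: by end_near. Qed.

(** Tensorization: slices of [f], [g], [h] at s, t and their midpoint satisfy the hypothesis in
    dimension d, so the induction hypothesis is exactly the hypothesis of [prekopa_1d] for the
    partial integrals. *)
Lemma prekopa (R : realType) d (f g h : 'rV[R]_d -> R) :
  gauss_decay f -> gauss_decay g -> gauss_decay h ->
  (forall y, 0 < f y) -> (forall y, 0 < g y) -> (forall y, 0 < h y) ->
  (forall x y, f x * g y <= h (2^-1 *: (x + y)) ^+ 2) ->
  RintRd f * RintRd g <= RintRd h ^+ 2.
Proof.
elim: d f g h => [|d IH] f g h hf hg hh f0 g0 h0 fgh /=.
  by have := fgh 0 0; rewrite addr0 scaler0.
have [c [C [c0 cf cg]]] := gauss_decay_common hf hg.
have [c' [C' [c0' ch]]] := hh.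
pose c1 := Num.min c c'; pose C1 := Num.max C C'.
have c10 : 0 < c1 by rewrite lt_min c0.
have df : gauss_dom f c1 C1 by apply: gauss_domW cf _ _; rewrite ?ge_min ?le_max lexx.
have dg : gauss_dom g c1 C1 by apply: gauss_domW cg _ _; rewrite ?ge_min ?le_max lexx.
have dh : gauss_dom h c1 C1 by apply: gauss_domW ch _ _; rewrite ?ge_min ?le_max
  lexx ?orbT.
apply: (prekopa_1d c10 (gauss_dom_slice c10 df) (gauss_dom_slice c10 dg)
  (gauss_dom_slice c10 dh)).
- by move=> t; apply: RintRd_gt0 => //; exact: gauss_decay_slice.
- by move=> t; apply: RintRd_gt0 => //; exact: gauss_decay_slice.
- by move=> t; apply: RintRd_gt0 => //; exact: gauss_decay_slice.
- move=> s t; apply: IH => //; try exact: gauss_decay_slice.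
  by move=> x y; rewrite (le_trans (fgh _ _))// vconsD vconsZ.
Qed.

(** * Gradient descent on smooth convex functions *)

(** [g] is a candidate gradient: the descent inequality is stated before any differentiability of
    [F] is known. *)
Definition upper_quad (R : realType) d (lambda : R) (F : 'rV[R]_d -> R)
    (g : 'rV[R]_d -> 'rV[R]_d) :=
  forall x h, F (x + h) <= F x + dot (g x) h + sq h / (lambda *+ 2).

Definition midpoint_convex (R : realType) d (F : 'rV[R]_d -> R) :=
  forall x y, 2 * F (2^-1 *: (x + y)) <= F x + F y.

Lemma scaler_half_addvv (R : realType) d (x : 'rV[R]_d) : 2^-1 *: (x + x) = x.
Proof. by rewrite scalerDr -scalerDl (_ : 2^-1 + 2^-1 = 1 :> R) ?scale1r//;
  field. Qed.

(** Midpoint convexity between [x + h] and [x - h] reflects the upper paraboloid at [- h] into a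
    lower one at [h]. *)
Lemma lower_quad (R : realType) d (lambda : R) (F : 'rV[R]_d -> R) g :
  upper_quad lambda F g -> midpoint_convex F ->
  forall x h, F x + dot (g x) h - sq h / (lambda *+ 2) <= F (x + h).
Proof.
move=> up mid x h; have := mid (x + h) (x - h); have := up x (- h).
have -> : 2^-1 *: (x + h + (x - h)) = x.
  by rewrite addrACA subrr addr0 scaler_half_addvv.
rewrite dotNr sqN; lra.
Qed.

(* The quadratic defect of lower_quad shrinks by 2^-n under n halvings of h. *)
Lemma first_order_convex (R : realType) d (lambda : R) (F : 'rV[R]_d -> R) g :
  upper_quad lambda F g -> midpoint_convex F ->
  forall x h, F x + dot (g x) h <= F (x + h).
Proof.
move=> up mid x h.
have halve n : F x + 2 ^+ n * (F (x + 2^-1 ^+ n *: h) - F x) <= F (x + h).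
  elim: n => [|n IH]; first by rewrite !expr0 mul1r scale1r addrCA subrr addr0.
  apply: le_trans IH; rewrite lerD2l exprSr -mulrA ler_pM2l ?exprn_gt0//.
  have := mid x (x + 2^-1 ^+ n *: h).
  have -> : 2^-1 *: (x + (x + 2^-1 ^+ n *: h)) = x + 2^-1 ^+ n.+1 *: h.
    by rewrite addrA scalerDr scalerA -exprS scaler_half_addvv.
  lra.
have lo n : F x + dot (g x) h - 2^-1 ^+ n * (sq h / (lambda *+ 2)) <= F (x + h).
  apply: le_trans (halve n); rewrite -addrA lerD2l.
  have := lower_quad up mid x (2^-1 ^+ n *: h).
  rewrite dotZr sqZ -mulrA => H.
  have e : (2 : R) ^+ n * 2^-1 ^+ n = 1.
    by rewrite -exprMn divff ?expr1n// pnatr_eq0.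
  have H' : 2^-1 ^+ n * (dot (g x) h - 2^-1 ^+ n * (sq h / (lambda *+ 2))) <=
      F (x + 2^-1 ^+ n *: h) - F x.
    by rewrite mulrBr mulrA -expr2; lra.
  have P0 : 0 <= (2 : R) ^+ n by rewrite exprn_ge0.
  by have := ler_wpM2l P0 H'; rewrite mulrA e mul1r.
have l : F x + dot (g x) h - 2^-1 ^+ n * (sq h / (lambda *+ 2)) @[n --> \oo] -->
   F x + dot (g x) h - 0 * (sq h / (lambda *+ 2)).
  apply: cvgB; first exact: cvg_cst.
  apply: cvgM; last exact: cvg_cst.
  apply: cvg_expr; rewrite ger0_norm ?invr_ge0// invf_lt1//; lra.
by move: l; rewrite mul0r subr0 => l; apply: (cvgr_to_le l); exact: nearW.
Qed.

Lemma sqZ_delta (R : realType) d i (t : R) :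
  sq (t *: delta_mx ord0 i : 'rV[R]_d) = t ^+ 2.
Proof.
rewrite sqZ /sq (bigD1 i)//= mxE !eqxx expr1n big1 ?addr0 ?mulr1// => j ji.
by rewrite mxE (negPf ji) andbF expr0n.
Qed.

Lemma dot_delta (R : realType) d i (u : 'rV[R]_d) :
  dot u (delta_mx ord0 i) = u ord0 i.
Proof.
rewrite /dot (bigD1 i)//= mxE !eqxx mulr1 big1 ?addr0// => j ji.
by rewrite mxE (negPf ji) andbF mulr0.
Qed.

(** Both paraboloids have slope [g x] at [x], so the difference quotient along a basis vector is
    within |t| / (2 lambda) of the coordinate of [g x]. *)
Lemma grad_quad (R : realType) d (lambda : R) (F : 'rV[R]_d -> R) g :
  0 < lambda -> upper_quad lambda F g -> midpoint_convex F ->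
  forall x, grad F x = g x.
Proof.
move=> l0 up mid x; apply/rowP => i; rewrite mxE.
apply/cvg_lim; first exact: Rhausdorff.
apply/cvgrPdist_le => e e0; near=> t.
have t0 : t != 0 by near: t; exact: nbhs_dnbhs_neq.
have tn : 0 < `|t| by rewrite normr_gt0.
have te : `|t| <= e * lambda.
  near: t; apply: dnbhs0_le; exact: mulr_gt0.
have := up x (t *: delta_mx ord0 i); have := lower_quad up mid x (t *: delta_mx
  ord0 i).
rewrite sqZ_delta dotZr dot_delta (addrC x) => h1 h2.
rewrite -(ler_pM2l tn) -normrM mulrBr [t * (_ *: _)]mulrA divff// mul1r.
apply: (@le_trans _ _ (t ^+ 2 / (lambda *+ 2))).
  rewrite -[X in `|X|]/(t * g x ord0 i - (F (t *: delta_mx ord0 i + x) - F x)).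
  by rewrite ler_norml; apply/andP; split; lra.
rewrite -real_normK ?num_real// expr2 -mulrA ler_pM2l//.
rewrite ler_pdivrMr ?mulrn_wgt0// (le_trans te)//.
by rewrite mulrnAr mulr2n lerDl mulr_ge0 ?ltW.
Unshelve. all: by end_near. Qed.

Lemma cocoercive (R : realType) d (lambda : R) (F : 'rV[R]_d -> R) g :
  0 < lambda -> upper_quad lambda F g ->
  (forall x h, F x + dot (g x) h <= F (x + h)) ->
  forall x y, lambda * sq (g y - g x) <= dot (g y - g x) (y - x).
Proof.
move=> l0 up lo.
(* The affine minorant at [x] and the paraboloid at [y] are compared at [y - lambda *: (g y - g x)],
   where their gap is smallest. Adding the inequality to its copy with x and y exchanged gives
   cocoercivity. *)
have H x y : F x + dot (g x) (y - x) + lambda / 2 * sq (g y - g x) <= F y.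
  have h1 := up y (- (lambda *: (g y - g x))).
  have h2 := lo x (y - x - lambda *: (g y - g x)).
  have e : x + (y - x - lambda *: (g y - g x)) = y - lambda *: (g y - g x).
    by rewrite addrA addrCA subrr addr0.
  rewrite e in h2; have := le_trans h2 h1.
  rewrite sqN sqZ !dotE -!dotvv !dotE (dotC (g x) (g y)).
  have -> : forall q, lambda ^+ 2 * q / (lambda *+ 2) = lambda / 2 * q.
    by move=> q; field; rewrite gt_eqF.
  lra.
move=> x y; have := H x y; have := H y x.
rewrite (sqBC (g x)) -!dotvv !dotE (dotC (g x) (g y)); lra.
Qed.

Lemma gd_step (R : realType) d (lambda : R) (F : 'rV[R]_d -> R) g x :
  0 < lambda -> upper_quad lambda F g ->
  F (x - lambda *: g x) <= F x - lambda / 2 * sq (g x).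
Proof.
move=> l0 up; have := up x (- (lambda *: g x)).
rewrite dotNr dotZr dotvv sqN sqZ.
have -> : lambda ^+ 2 * sq (g x) / (lambda *+ 2) = lambda / 2 * sq (g x).
  by field; rewrite gt_eqF.
lra.
Qed.

Lemma gd_rate (R : realType) d (lambda : R) (F : 'rV[R]_d -> R) g
    (x : nat -> 'rV[R]_d) xs k :
  0 < lambda -> upper_quad lambda F g ->
  (forall x h, F x + dot (g x) h <= F (x + h)) ->
  (forall k, x k.+1 = x k - lambda *: g (x k)) ->
  (forall y, F xs <= F y) -> (1 <= k)%N ->
  enorm (g (x k)) <= 2 * enorm (x 0%N - xs) / (lambda * k.+1%:R).
Proof.
move=> l0 up lo xS xsmin k1.
have desc n : F (x n.+1) <= F (x n) - lambda / 2 * sq (g (x n)).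
  by rewrite xS; exact: gd_step.
(* Along a gradient step cocoercivity bounds the square of the new gradient by its product with the
   old one. *)
have mono n : sq (g (x n.+1)) <= sq (g (x n)).
  have := cocoercive l0 up lo (x n) (x n.+1).
  have -> : x n.+1 - x n = - (lambda *: g (x n)).
    by rewrite xS addrAC subrr sub0r.
  rewrite dotNr dotZr -mulrN ler_pM2l//.
  have := sq_ge0 (g (x n.+1) - g (x n)).
  rewrite sqB dotDl dotNl dotvv; lra.
have pot n : sq (x n - xs) + 2 * lambda * n%:R * (F (x n) - F xs) +
    lambda ^+ 2 * (n%:R * (n%:R - 1) / 2) * sq (g (x n)) <= sq (x 0%N - xs).
  elim: n => [|n IH]; first by rewrite !(mulr0, mul0r) !addr0.
  apply: le_trans IH.
  have h1 := desc n; have h2 := mono n.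
  have h3 := lo (x n) (xs - x n); rewrite addrCA subrr addr0 in h3.
  have e : sq (x n.+1 - xs) = sq (x n - xs) + 2 * lambda * dot (g (x n)) (xs - x n)
     + lambda ^+ 2 * sq (g (x n)).
    have -> : x n.+1 - xs = (x n - xs) - lambda *: g (x n) by rewrite xS addrAC.
    rewrite [LHS]sqB sqZ dotZr -(opprB xs) sqN dotNl (dotC (xs - x n)).
    by rewrite mulr2n; ring.
  rewrite e (_ : n.+1%:R = n%:R + 1 :> R); last by rewrite natr1.
  have := ler0n R n; move: (n%:R : R) => N N0.
  have l2 : 0 <= lambda ^+ 2 by rewrite exprn_ge0// ltW.
  have a1 : lambda * dot (g (x n)) (xs - x n) <= lambda * (F xs - F (x n)).
    by rewrite ler_pM2l//; lra.
  have a2 : lambda * (N + 1) * F (x n.+1) <=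
      lambda * (N + 1) * (F (x n) - lambda / 2 * sq (g (x n))).
    by rewrite ler_wpM2l// mulr_ge0 ?ltW//; lra.
  have a3 : lambda ^+ 2 * ((N + 1) * N / 2) * sq (g (x n.+1)) <=
      lambda ^+ 2 * ((N + 1) * N / 2) * sq (g (x n)).
    by rewrite ler_wpM2l// mulr_ge0// divr_ge0// mulr_ge0//; lra.
  move: a1 a2 a3; move: (dot _ _) (F (x n.+1)) (F (x n)) (F xs) (sq (g (x n)))
    (sq (g (x n.+1))) (sq (x n - xs)) => D F1 F0 Fs G0 G1 S a1 a2 a3.
  rewrite -subr_ge0.
  (* The decrease of the potential is an exact nonnegative combination of the slacks in convexity
     ([a1]), descent ([a2]) and monotonicity of the gradient norm ([a3]). *)
  have -> : S + 2 * lambda * N * (F0 - Fs) + lambda ^+ 2 * (N * (N - 1) / 2) * G0 -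
   (S + 2 * lambda * D + lambda ^+ 2 * G0 + 2 * lambda * (N + 1) * (F1 - Fs) +
    lambda ^+ 2 * ((N + 1) * (N + 1 - 1) / 2) * G1) =
    2 * (lambda * (Fs - F0) - lambda * D) +
    2 * (lambda * (N + 1) * (F0 - lambda / 2 * G0) - lambda * (N + 1) * F1) +
    (lambda ^+ 2 * ((N + 1) * N / 2) * G0 - lambda ^+ 2 * ((N + 1) * N / 2) * G1).
    by field.
  by apply: addr_ge0; [apply: addr_ge0; rewrite mulr_ge0// subr_ge0|rewrite subr_ge0].
(* One further descent step gives F(x_k) - F(xs) >= lambda |g|^2 / 2, so the potential bounds
   lambda^2 k(k+1) |g|^2 / 2. For k >= 1 one has 2k(k+1) >= (k+1)^2, with difference (k+1)(k-1);
   hence the factor 2. *)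
have := pot k; have := desc k; have := xsmin (x k.+1) => hs hd hp.
have k1' : 1 <= k%:R :> R by rewrite ler1n.
rewrite ler_pdivlMr ?mulr_gt0// -(@ler_pXn2r _ 2)// ?nnegrE; last 2 first.
- by rewrite !mulr_ge0 ?enorm_ge0 ?(ltW l0).
- by rewrite mulr_ge0 ?enorm_ge0.
rewrite !exprMn !enorm_sqr (_ : k.+1%:R = k%:R + 1 :> R); last by rewrite natr1.
move: hp hs hd k1' (sq_ge0 (x k - xs)) (sq_ge0 (g (x k))).
move: (F (x k.+1)) (F (x k)) (F xs) (sq (g (x k))) (sq (x k - xs)) (k%:R : R) (sq
  (x 0%N - xs)).
move=> F1 F0 Fs G S N S0 hp hs hd N1 S_ge0 G0.
have a1 : lambda * N * (lambda / 2 * G) <= lambda * N * (F0 - Fs).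
  by rewrite ler_pM2l ?mulr_gt0//; lra.
have a2 : 0 <= lambda ^+ 2 * G * ((N + 1) * (N - 1)).
  by rewrite !mulr_ge0 ?exprn_ge0 ?(ltW l0)//; lra.
have e : 2 ^+ 2 * (S + 2 * lambda * N * (F0 - Fs) + lambda ^+ 2 * (N * (N - 1) /
  2) * G) -
    G * (lambda ^+ 2 * (N + 1) ^+ 2) = 4 * S +
    8 * (lambda * N * (F0 - Fs) - lambda * N * (lambda / 2 * G)) +
    lambda ^+ 2 * G * ((N + 1) * (N - 1)).
  by field.
rewrite -subr_ge0; apply: (@le_trans _ _ (2 ^+ 2 * (S + 2 * lambda * N * (F0 -
  Fs) + lambda ^+ 2 * (N * (N - 1) / 2) * G) -
    G * (lambda ^+ 2 * (N + 1) ^+ 2))); last by rewrite lerD2r ler_pM2l ?exprn_gt0.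
rewrite e; apply: addr_ge0 => //; apply: addr_ge0; first by rewrite mulr_ge0.
by rewrite mulr_ge0// subr_ge0.
Qed.

(** * Moments of a positive weight *)

Definition quad_growth (R : realType) d (p : 'rV[R]_d -> R) :=
  continuous p /\ exists A, forall y, `|p y| <= A * (1 + sq y).

(** Half of the Gaussian rate absorbs the polynomial, by 1 + r <= (1 + 2/c) exp(c r / 2) for r >=
    0. *)
Lemma gauss_decay_mul (R : realType) d (p w : 'rV[R]_d -> R) :
  quad_growth p -> gauss_decay w -> gauss_decay (fun y => p y * w y).
Proof.
move=> [cp [A hA]] [c [C [c0 gw]]].
have C0 := gauss_dom_C_ge0 gw.
have A0 : 0 <= A.
  by have := hA 0; rewrite sq0 addr0 mulr1; apply: le_trans.
exists (c / 2), (A * (1 + 2 / c) * C); split; first by rewrite divr_gt0.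
split; first by apply: continuous_fM => //; exact: gw.1.
move=> y; rewrite normrM.
have h1 : 1 + sq y <= (1 + 2 / c) * expR (c / 2 * sq y).
  have s0 := sq_ge0 y.
  have e1 : 1 <= expR (c / 2 * sq y).
    by rewrite -[leLHS]expR0 ler_expR mulr_ge0// divr_ge0// ltW.
  have e2 : sq y <= 2 / c * expR (c / 2 * sq y).
    rewrite -ler_pdivrMl ?divr_gt0// invf_div.
    by apply: le_trans (expR_ge1Dx _); rewrite lerDr.
  by rewrite mulrDl mul1r lerD.
apply: (@le_trans _ _ (A * ((1 + 2 / c) * expR (c / 2 * sq y)) *
   (C * expR (- (c * sq y))))).
  rewrite ler_pM//; last exact: gw.2.
  by rewrite (le_trans (hA y))// ler_wpM2l.
rewrite le_eqVlt; apply/orP; left; apply/eqP.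
have -> : expR (- (c / 2 * sq y)) = expR (c / 2 * sq y) * expR (- (c * sq y)).
  by rewrite -expRD; congr expR; field.
by ring.
Qed.

Lemma dot_continuous (R : realType) d (b : 'rV[R]_d) : continuous (dot b).
Proof.
move=> y; apply: (@cvg_sum_ord _ _ (nbhs y)) => i.
by apply: cvgM; [exact: cvg_cst|exact: coord_continuous].
Qed.

Lemma quad_growthD (R : realType) d (p q : 'rV[R]_d -> R) :
  quad_growth p -> quad_growth q -> quad_growth (fun y => p y + q y).
Proof.
move=> [cp [A hA]] [cq [B hB]]; split; first exact: continuous_fD.
exists (A + B) => y; rewrite (le_trans (ler_normD _ _))// mulrDl.
exact: lerD.
Qed.

Lemma quad_growthZ (R : realType) d a (p : 'rV[R]_d -> R) :
  quad_growth p -> quad_growth (fun y => a * p y).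
Proof.
move=> [cp [A hA]]; split; first by apply: continuous_fM => //; exact:
  continuous_cstf.
by exists (`|a| * A) => y; rewrite normrM -mulrA ler_wpM2l.
Qed.

Lemma quad_growth_cst (R : realType) d (a : R) :
  quad_growth (fun _ : 'rV[R]_d => a).
Proof.
split; first exact: continuous_cstf.
by exists `|a| => y; rewrite ler_peMr// lerDl sq_ge0.
Qed.

Lemma quad_growth_coord (R : realType) d (i : 'I_d) :
  quad_growth (fun y : 'rV[R]_d => y ord0 i).
Proof.
split; first by move=> y; exact: coord_continuous.
exists 1 => y; rewrite mul1r; have := sq_coord y i.
have := sqr_ge0 (`|y ord0 i| - 1); rewrite sqrrB real_normK ?num_real//.
by rewrite expr1n mulr1; have := normr_ge0 (y ord0 i); nra.
Qed.

Lemma quad_growth_sq (R : realType) d (z : 'rV[R]_d) :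
  quad_growth (fun y => sq (y - z)).
Proof.
split.
  have -> : (fun y => sq (y - z)) = (fun y => sq y + -2 * dot z y + sq z).
    by apply/funext => y; rewrite sqB (dotC y) -mulr_natl; ring.
  apply: continuous_fD; last exact: continuous_cstf.
  apply: continuous_fD; first exact: sq_continuous.
  by apply: continuous_fM; [exact: continuous_cstf|exact: dot_continuous].
exists (2 + 2 * sq z) => y; rewrite ger0_norm ?sq_ge0//.
apply: le_trans (sqD_le y (- z)) _; rewrite sqN.
have := sq_ge0 y; have := sq_ge0 z; nra.
Qed.

(** Expectation under the probability measure proportional to [w]; the weight itself stays
    unnormalized. *)
Definition wexpect (R : realType) d (w p : 'rV[R]_d -> R) : R :=
  RintRd (fun y => p y * w y) / RintRd w.

Definition mean (R : realType) d (w : 'rV[R]_d -> R) : 'rV[R]_d :=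
  \row_i wexpect w (fun y => y ord0 i).

Definition var (R : realType) d (w : 'rV[R]_d -> R) : R :=
  wexpect w (fun y => sq (y - mean w)).

Lemma wexpectD (R : realType) d (w p q : 'rV[R]_d -> R) : gauss_decay w ->
  quad_growth p -> quad_growth q -> wexpect w (fun y => p y + q y) = wexpect w p
    + wexpect w q.
Proof.
move=> hw hp hq; rewrite /wexpect -mulrDl -RintRdD; try exact: gauss_decay_mul.
by congr (_ / _); apply: eq_RintRd => y; rewrite mulrDl.
Qed.

Lemma wexpectZ (R : realType) d (w p : 'rV[R]_d -> R) a : gauss_decay w ->
  quad_growth p -> wexpect w (fun y => a * p y) = a * wexpect w p.
Proof.
move=> hw hp; rewrite /wexpect mulrA -RintRdZ; last exact: gauss_decay_mul.
by congr (_ / _); apply: eq_RintRd => y; rewrite mulrA.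
Qed.

Lemma wexpect_cst (R : realType) d (w : 'rV[R]_d -> R) a : gauss_decay w ->
  (forall y, 0 < w y) -> wexpect w (fun=> a) = a.
Proof.
move=> hw w0; rewrite /wexpect RintRdZ// mulfK// gt_eqF//; exact: RintRd_gt0.
Qed.

Lemma wexpect_sum (R : realType) d (w : 'rV[R]_d -> R) n (b : 'I_n -> R)
    (p : 'I_n -> 'rV[R]_d -> R) : gauss_decay w -> (forall y, 0 < w y) ->
  (forall i, quad_growth (p i)) ->
  quad_growth (fun y => \sum_(i < n) b i * p i y) /\
  wexpect w (fun y => \sum_(i < n) b i * p i y) = \sum_(i < n) b i * wexpect w (p i).
Proof.
move=> hw w0; elim: n b p => [|n IH] b p hp.
  have -> : (fun y => \sum_(i < 0) b i * p i y) = (fun=> 0).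
    by apply/funext => y; rewrite big_ord0.
  by rewrite big_ord0 wexpect_cst//; split=> //; exact: quad_growth_cst.
have -> : (fun y => \sum_(i < n.+1) b i * p i y) =
    (fun y => b ord0 * p ord0 y + \sum_(i < n) b (lift ord0 i) * p (lift ord0 i) y).
  by apply/funext => y; rewrite big_ord_recl.
have [q e] := IH (fun i => b (lift ord0 i)) _ (fun i => hp (lift ord0 i)).
have q0 : quad_growth (fun y => b ord0 * p ord0 y) by exact: quad_growthZ.
by rewrite wexpectD// wexpectZ// e big_ord_recl; split=> //; exact: quad_growthD.
Qed.

Lemma wexpect_dot (R : realType) d (w : 'rV[R]_d -> R) b : gauss_decay w ->
  (forall y, 0 < w y) ->
  quad_growth (dot b) /\ wexpect w (dot b) = dot b (mean w).
Proof.
move=> hw w0.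
have [q e] := wexpect_sum (fun i => b ord0 i) hw w0 (@quad_growth_coord R d).
split; first exact: q.
by rewrite [LHS]e; apply: eq_bigr => i _; rewrite mxE.
Qed.

Lemma wexpect_quad (R : realType) d (w : 'rV[R]_d -> R) a b e : gauss_decay w ->
  (forall y, 0 < w y) ->
  quad_growth (fun y => a + dot b y + e * sq (y - mean w)) /\
  wexpect w (fun y => a + dot b y + e * sq (y - mean w)) =
  a + dot b (mean w) + e * var w.
Proof.
move=> hw w0; have [qd ed] := wexpect_dot b hw w0.
have q1 : quad_growth (fun y => a + dot b y).
  by apply: quad_growthD => //; exact: quad_growth_cst.
have q2 : quad_growth (fun y => e * sq (y - mean w)).
  by apply: quad_growthZ; exact: quad_growth_sq.
split; first exact: quad_growthD.
rewrite wexpectD// wexpectD//; last exact: quad_growth_cst.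
by rewrite wexpect_cst// ed wexpectZ//; exact: quad_growth_sq.
Qed.

(** The device behind the later integral estimates: a pointwise minorant of [v] by a quadratic times
    [w] integrates in closed form through the mean and variance of [w]. *)
Lemma RintRd_ge_quad (R : realType) d (w v : 'rV[R]_d -> R) a b e :
  gauss_decay w -> (forall y, 0 < w y) -> gauss_decay v ->
  (forall y, (a + dot b y + e * sq (y - mean w)) * w y <= v y) ->
  (a + dot b (mean w) + e * var w) * RintRd w <= RintRd v.
Proof.
move=> hw w0 hv h; have [q1 <-] := wexpect_quad a b e hw w0.
rewrite /wexpect divfK ?gt_eqF ?RintRd_gt0//.
by apply: RintRd_le => //; exact: gauss_decay_mul.
Qed.

Lemma var_ge0 (R : realType) d (w : 'rV[R]_d -> R) : (forall y, 0 < w y) ->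
  0 <= var w.
Proof.
move=> w0; rewrite /var /wexpect divr_ge0//; apply: RintRd_ge0 => y.
- by rewrite mulr_ge0 ?sq_ge0// ltW.
- exact: ltW.
Qed.

(** * The soft Moreau envelope *)

(** The Gaussian normalization is kept, so that [gibbs_mass] is by conversion the expectation inside
    the envelope. *)
Definition gibbs (R : realType) d (delta lambda : R) (f : 'rV[R]_d -> R)
    (x y : 'rV[R]_d) : R :=
  expR (- f y / delta) * gauss_density x (lambda * delta) y.

Definition gibbs_mass (R : realType) d (delta lambda : R) (f : 'rV[R]_d -> R)
    (x : 'rV[R]_d) : R := RintRd (gibbs delta lambda f x).

Section envelope.
Context (R : realType) (d : nat) (delta lambda : R) (f : 'rV[R]_d -> R).
Context (delta0 : 0 < delta) (lambda0 : 0 < lambda).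
Context (cf : continuous f) (xs : 'rV[R]_d) (xsmin : forall y, f xs <= f y).

Local Notation w := (gibbs delta lambda f).
Local Notation Z := (gibbs_mass delta lambda f).
Local Notation F := (soft_moreau lambda delta f).

Lemma gauss_var_gt0 : 0 < lambda * delta.
Proof. exact: mulr_gt0. Qed.

Lemma gauss_norm_gt0 : 0 < (Num.sqrt (pi *+ 2 * (lambda * delta))) ^- d :> R.
Proof.
by rewrite invr_gt0 exprn_gt0// sqrtr_gt0 mulr_gt0 ?gauss_var_gt0// mulrn_wgt0//
  pi_gt0.
Qed.

Lemma gibbsE x y : w x y = (Num.sqrt (pi *+ 2 * (lambda * delta))) ^- d *
  expR (- f y / delta - sq (y - x) / (lambda * delta *+ 2)).
Proof.
rewrite /gibbs /gauss_density enorm_sqr mulrCA -expRD.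
by congr (_ * expR (_ + _)); rewrite mulNr.
Qed.

Lemma gibbs_gt0 x y : 0 < w x y.
Proof. by rewrite gibbsE mulr_gt0 ?gauss_norm_gt0 ?expR_gt0. Qed.

Lemma gibbs_continuous x : continuous (w x).
Proof.
have -> : w x = (fun y => (Num.sqrt (pi *+ 2 * (lambda * delta))) ^- d *
    expR (f y * (- delta^-1) + sq (y - x) * (- (lambda * delta *+ 2)^-1))).
  by apply/funext => y; rewrite gibbsE !mulrN !mulNr.
apply: continuous_fM; first exact: continuous_cstf.
apply: (@continuous_compf _ _ _ _ (@expR R)); last exact: continuous_expR.
apply: continuous_fD; apply: continuous_fM => //; try exact: continuous_cstf.
exact: (quad_growth_sq x).1.
Qed.

Lemma gauss_decay_gibbs x : gauss_decay (w x).
Proof.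
set N := (Num.sqrt (pi *+ 2 * (lambda * delta))) ^- d : R.
have s20 := gauss_var_gt0; pose c := (lambda * delta *+ 2)^-1.
have c0 : 0 < c by rewrite invr_gt0 mulrn_wgt0.
(* [f] is bounded below by [f xs], and |y|^2 <= 2 |y - x|^2 + 2 |x|^2 recentres the Gaussian at 0 at
   the cost of half its rate. *)
exists (c / 2), (N * expR (- f xs / delta + c * sq x)); split.
  by rewrite divr_gt0.
split; first exact: gibbs_continuous.
move=> y; rewrite gtr0_norm ?gibbs_gt0// gibbsE -mulrA -expRD.
rewrite ler_pM2l ?gauss_norm_gt0// ler_expR -addrA lerD//.
  by rewrite ler_pM2r ?invr_gt0// lerN2.
rewrite -/c (mulrC _ c).
have := sqD_le (y - x) x; rewrite subrK => h.
by have := ler_wpM2l (ltW c0) h; lra.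
Qed.

Lemma Z_gt0 x : 0 < Z x.
Proof. by apply: RintRd_gt0; [exact: gauss_decay_gibbs|exact: gibbs_gt0]. Qed.

Lemma soft_moreauE x : F x = - delta * ln (Z x).
Proof. by []. Qed.

Lemma zproxE x : zprox delta lambda f x = mean (w x).
Proof.
apply/rowP => i; rewrite !mxE /wexpect; congr (_ / _).
by apply: eq_RintRd => y; rewrite /gibbs mulrA.
Qed.

(** Jensen in tangent form: the log-ratio u of the two weights is affine in y with mean [s], and exp
    u >= exp s (1 + u - s) is integrated against [w x]. The coefficients passed to [RintRd_ge_quad]
    spell out this tangent. *)
Lemma Z_shift_ge x h : Z x * expR ((dot h (mean (w x) - x) - sq h / 2) /
  (lambda * delta)) <= Z (x + h).
Proof.
set s := (_ / (lambda * delta)).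
pose k := (lambda * delta)^-1.
have s20 := gauss_var_gt0.
have := @RintRd_ge_quad R d (w x) (w (x + h))
  (expR s * (1 - s + k * (- dot h x - sq h / 2))) ((expR s * k) *: h) 0
  (gauss_decay_gibbs x) (gibbs_gt0 x) (gauss_decay_gibbs (x + h)).
rewrite mul0r addr0 dotZl => H.
have e : expR s * (1 - s + k * (- dot h x - sq h / 2)) + expR s * k * dot h (mean
  (w x)) = expR s.
  rewrite /s dotDr dotNr -/k; ring.
rewrite mulrC -[X in X * _]e; apply: H => y.
rewrite mul0r addr0 !gibbsE mulrCA ler_pM2l ?gauss_norm_gt0//.
have -> : - f y / delta - sq (y - (x + h)) / (lambda * delta *+ 2) =
   (- f y / delta - sq (y - x) / (lambda * delta *+ 2)) +
   k * (dot h y - dot h x - sq h / 2).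
  rewrite opprD addrA (sqB (y - x)) (dotC _ h) dotDr dotNr /k -(mulr_natr _ 2).
  by field; rewrite !gt_eqF.
rewrite [leRHS]expRD [leRHS]mulrC ler_pM2r ?expR_gt0// dotZl.
pose u := k * (dot h y - dot h x - sq h / 2).
rewrite -/u (_ : expR u = expR (s + (u - s))); last by rewrite addrCA subrr addr0.
rewrite expRD -mulrA -mulrDr ler_pM2l ?expR_gt0//.
apply: le_trans (expR_ge1Dx (u - s)).
by rewrite /u; lra.
Qed.

Lemma soft_moreau_upper : upper_quad lambda F
  (fun x => lambda^-1 *: (x - zprox delta lambda f x)).
Proof.
move=> x h; rewrite !soft_moreauE zproxE.
have := Z_shift_ge x h; rewrite -ler_ln ?posrE ?mulr_gt0 ?Z_gt0 ?expR_gt0//.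
rewrite lnM ?posrE ?Z_gt0 ?expR_gt0// expRK => H.
have := ler_wpM2l (ltW delta0) H; rewrite dotZl.
rewrite (_ : dot (x - mean (w x)) h = - dot h (mean (w x) - x)); last first.
  by rewrite dotC -opprB dotNr.
rewrite mulrDr.
have -> : delta * ((dot h (mean (w x) - x) - sq h / 2) / (lambda * delta)) =
   lambda^-1 * dot h (mean (w x) - x) - sq h / (lambda *+ 2).
  by rewrite -(mulr_natr _ 2); field; rewrite !gt_eqF.
move=> {H}; move: (ln (Z x)) (ln (Z (x + h))) (dot h (mean (w x) - x)) => a b c.
lra.
Qed.

Context (convf : convex_fun f).

(** Joint midpoint log-concavity in the centre and the point, from convexity of [f] and of the
    squared distance: the Prekopa-Leindler hypothesis for the three weights. *)
Lemma gibbs_midpoint x x' y y' :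
  w x y * w x' y' <= w (2^-1 *: (x + x')) (2^-1 *: (y + y')) ^+ 2.
Proof.
rewrite !gibbsE exprMn mulrACA -expr2 ler_pM2l ?exprn_gt0 ?gauss_norm_gt0//.
rewrite -expRD -expRM_natl ler_expR.
have h1 : f (2^-1 *: (y + y')) <= (f y + f y') / 2.
  have := @convf y y' 2^-1; rewrite invr_ge0 ler0n => /(_ isT).
  rewrite (_ : 1 - 2^-1 = 2^-1 :> R); last by field.
  rewrite -scalerDr; have h2 : 2^-1 <= 1 :> R by rewrite invf_le1// ler1n.
  by move=> /(_ h2); lra.
have h2 : sq (2^-1 *: (y + y') - 2^-1 *: (x + x')) <= (sq (y - x) + sq (y' - x')) / 2.
  rewrite -scalerBr sqZ opprD addrACA.
  by have := sqD_le (y - x) (y' - x'); lra.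
have k1 : 0 < delta^-1 by rewrite invr_gt0.
have k2 : 0 < (lambda * delta *+ 2)^-1 by rewrite invr_gt0 mulrn_wgt0// gauss_var_gt0.
have := ler_wpM2l (ltW k1) h1; have := ler_wpM2l (ltW k2) h2.
move: (sq _) (f _) => A B; lra.
Qed.

Lemma soft_moreau_midpoint : midpoint_convex F.
Proof.
move=> x y; rewrite !soft_moreauE.
have Zx := Z_gt0 x; have Zy := Z_gt0 y; have Zm := Z_gt0 (2^-1 *: (x + y)).
have : Z x * Z y <= Z (2^-1 *: (x + y)) ^+ 2.
  exact: prekopa (gauss_decay_gibbs _) (gauss_decay_gibbs _) (gauss_decay_gibbs
    _) (gibbs_gt0 _)
    (gibbs_gt0 _) (gibbs_gt0 _) (gibbs_midpoint x y).
move: (Z x) (Z y) (Z (2^-1 *: (x + y))) Zx Zy Zm => a b c a0 b0 c0.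
rewrite -ler_ln ?posrE ?exprn_gt0 ?mulr_gt0// lnM// lnXn// => H.
by have := ler_wpM2l (ltW delta0) H; rewrite -mulr_natr; lra.
Qed.
End envelope.

(** * Mean and variance of the proximal Gibbs measure *)

Lemma gauss_decay_affine (R : realType) d (g : 'rV[R]_d -> R) (a : 'rV[R]_d) (b : R) :
  gauss_decay g -> 0 < b -> gauss_decay (fun y => g (a + b *: y)).
Proof.
move=> [c [C [c0 gg]]] b0; exists (c * b ^+ 2 / 2), (C * expR (c * sq a)).
split; first by rewrite divr_gt0// mulr_gt0// exprn_gt0.
split.
  apply: (@continuous_compf _ _ _ (fun y : 'rV[R]_d => a + b *: y) g _ gg.1) => y.
  apply: (@cvg_vec _ _ (nbhs y)) => i; rewrite !mxE.
  under eq_fun do rewrite !mxE.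
  apply: cvgD; first exact: cvg_cst.
  by apply: cvgM; [exact: cvg_cst|exact: coord_continuous].
move=> y; rewrite (le_trans (gg.2 _))// -mulrA -expRD ler_wpM2l ?(gauss_dom_C_ge0
  gg)//.
rewrite ler_expR.
have := sqD_le (a + b *: y) (- a); rewrite addrAC subrr add0r sqN sqZ => h.
have := ler_wpM2l (ltW c0) h; rewrite !mulrDr; lra.
Qed.

(** Lets a parameter tend to 0 in an inequality whose remainder is linear in it, with no explicit
    limit. *)
Lemma ge0_of_affine_ge0 (R : realType) (a b : R) :
  (forall t, 0 < t -> t <= 1 -> 0 <= a + t * b) -> 0 <= a.
Proof.
move=> h; rewrite leNgt; apply/negP => a0.
pose t := Num.min 1 (- a / (2 * (1 + `|b|))).
have k0 : 0 < 2 * (1 + `|b|) by rewrite mulr_gt0// ltr_pwDl.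
have t0 : 0 < t by rewrite lt_min ltr01 divr_gt0// oppr_gt0.
have t1 : t <= 1 by rewrite ge_min lexx.
have := h t t0 t1; apply/negP; rewrite -ltNge.
have : t * (2 * (1 + `|b|)) <= - a by rewrite -ler_pdivlMr// ge_min lexx orbT.
have : t * b <= t * `|b| by rewrite ler_pM2l// ler_norm.
have : 0 <= t * `|b| by rewrite mulr_ge0// ltW.
lra.
Qed.

Lemma exists_minimizer (R : realType) d (phi : 'rV[R]_d -> R) (y0 : 'rV[R]_d) rho :
  continuous phi -> (forall y, phi y <= phi y0 -> sq y <= rho) ->
  exists q, forall y, phi q <= phi y.
Proof.
move=> cphi hb; pose A := [set y | phi y <= phi y0].
have A0 : A !=set0 by exists y0; rewrite /A/=.
have cA : compact A.
  apply: bounded_closed_compact; last first.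
    rewrite (_ : A = phi @^-1` [set t | t <= phi y0])//.
    by apply: closed_comp => [y _|]; [exact: cphi|exact: closed_le].
  (* A coordinate whose square is at most [rho] has absolute value below [1 + rho], so no square
     root is taken. *)
  exists (1 + rho); split; first exact: num_real.
  move=> M hM y /hb yr; apply/ltW; apply: normv_lt.
    by have := sq_ge0 y; lra.
  move=> i; have := sq_coord y i.
  rewrite -real_normK ?num_real//; have := normr_ge0 (y ord0 i); nra.
have [|q qA qmin] := @EVT_min_rV R d phi A A0 cA.
  exact: continuous_subspaceT.
exists q => y; have [yA|yA] := lerP (phi y) (phi y0).
  by apply: qmin; exact/mem_set.
by apply: le_trans (ltW yA); move/set_mem: qA.
Qed.

Lemma continuous_sq (R : realType) d (f : 'rV[R]_d -> R) (m : 'rV[R]_d) (eta : R) :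
  {for m, continuous f} -> 0 < eta ->
  exists2 e, 0 < e & forall y, sq (y - m) < e -> `|f m - f y| < eta.
Proof.
move=> cf eta0; have /cvgrPdist_lt/(_ _ eta0) := cf.
move=> /nbhs_normP[e /= e0 he]; exists (e ^+ 2); first by rewrite exprn_gt0.
move=> y ye; apply: he => /=; apply: normv_lt => // i.
rewrite -(@ltr_pXn2r _ 2)// ?nnegrE ?(ltW e0)// real_normK ?num_real//.
by rewrite (le_lt_trans _ ye)// -sqBC sq_coord.
Qed.

(* q is a proximal point of m, s the proximal residual. *)
Lemma approx_subgradient (R : realType) d (f : 'rV[R]_d -> R) (xs m : 'rV[R]_d)
    (eta : R) : convex_fun f -> continuous f -> (forall y, f xs <= f y) ->
  0 < eta -> exists q s, [/\ f m - eta <= f q, 0 <= dot s (m - q) &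
    forall y, f q + dot s (y - q) <= f y].
Proof.
move=> convf cf xsmin eta0.
have [e e0 he] := continuous_sq (cf m) eta0.
(* [K * e] exceeds [f m - f xs], the most that [f] can drop below [f m]; the minimizer of [phi]
   therefore stays in the ball where [f] is within [eta] of [f m]. *)
pose K := (1 + (f m - f xs)) / e.
have fm0 : 0 <= f m - f xs by rewrite subr_ge0.
have K0 : 0 < K by rewrite divr_gt0// ltr_pwDl.
pose phi y := f y + K * sq (y - m).
have level y : phi y <= phi m -> sq (y - m) < e.
  rewrite /phi subrr sq0 mulr0 addr0 => h.
  rewrite -(ltr_pM2l K0); apply: (@le_lt_trans _ _ (f m - f xs)).
    by have := xsmin y; lra.
  by rewrite /K divfK ?gt_eqF// ltrDr.
have [||q qmin] := @exists_minimizer R d phi m (2 * e + 2 * sq m).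
- apply: continuous_fD => //; apply: continuous_fM; first exact: continuous_cstf.
  exact: (quad_growth_sq m).1.
- move=> y /level h; have := sqD_le (y - m) m; rewrite subrK; lra.
exists q, ((2 * K) *: (m - q)); split.
- by have := he q (level _ (qmin m)); rewrite ltr_norml; lra.
- by rewrite dotZl dotvv mulr_ge0 ?sq_ge0// mulr_ge0// ltW.
(* Optimality of [q] is tested at (1 - t) q + t y; after convexity and division by [t] the remainder
   is [t * (K * sq (y - q))]. *)
- move=> y; rewrite -subr_ge0; apply: (@ge0_of_affine_ge0 _ _ (K * sq (y - q)))
  => t t0 t1.
  have := qmin ((1 - t) *: q + t *: y); rewrite /phi.
  have -> : (1 - t) *: q + t *: y - m = (q - m) + t *: (y - q).
    by apply/rowP => i; rewrite !mxE; ring.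
  have := convf q y t (ltW t0) t1.
  rewrite (sqD (q - m)) sqZ dotZr -(opprB m q) dotNl sqN dotZl => h1 h2.
  rewrite -(ler_pM2l t0) mulr0.
  move: h1 h2; rewrite -mulr_natl; move: (f (_ + _)) (dot _ _) (sq (m - q)) (sq
    (y - q)).
  by move=> a b c r h1 h2; nra.
Qed.

Lemma sq_combine (R : realType) d (u v : 'rV[R]_d) (t : R) :
  sq ((1 - t) *: u + t *: v) =
  (1 - t) * sq u + t * sq v - t * (1 - t) * sq (v - u).
Proof.
rewrite [LHS]sqD sqB !sqZ dotZl dotZr (dotC v).
by move: (sq u) (sq v) (dot u v) => a b c; ring.
Qed.

Section moments.
Context (R : realType) (d : nat) (delta lambda : R) (f : 'rV[R]_d -> R).
Context (delta0 : 0 < delta) (lambda0 : 0 < lambda).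
Context (cf : continuous f) (xs : 'rV[R]_d) (xsmin : forall y, f xs <= f y).
Context (convf : convex_fun f).

Local Notation w := (gibbs delta lambda f).
Local Notation Z := (gibbs_mass delta lambda f).

(** [s] bounds the log-ratio of the weights from below; using 1 + s <= exp s keeps the bound linear
    in [s], hence computable by moments. *)
Lemma gibbs_ge_exp x y y' s :
  s <= (f y - f y') / delta + (sq (y - x) - sq (y' - x)) / (lambda * delta *+ 2) ->
  (1 + s) * w x y <= w x y'.
Proof.
move=> h; rewrite !gibbsE mulrCA ler_pM2l ?gauss_norm_gt0//.
set E := (X in _ * expR X); set E' := (X in _ <= expR X).
have -> : E' = (E' - E) + E by rewrite subrK.
rewrite [leRHS]expRD ler_pM2r ?expR_gt0// (le_trans _ (expR_ge1Dx _))// lerD2l.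
apply: le_trans h _; rewrite /E /E' !mulrBl !mulNr; lra.
Qed.

(** Convexity bounds [f] at the dilated point, and the affine minorant at [q] then replaces [f y],
    so that the factor in front of the weight is quadratic in [y]. *)
Lemma gibbs_dilation x y z q s t : 0 < t -> t < 1 ->
  (forall y, f q + dot s (y - q) <= f y) ->
  (1 + (1 - t) / delta * (f q + dot s (y - q) - f z +
    (sq (y - x) - sq (z - x) + t * sq (y - z)) / (lambda *+ 2))) * w x y <=
  w x ((1 - t) *: z + t *: y).
Proof.
move=> t0 t1 hs; apply: gibbs_ge_exp.
have h1 := convf z y (ltW t0) (ltW t1); have h2 := hs y.
have -> : sq ((1 - t) *: z + t *: y - x) =
    (1 - t) * sq (z - x) + t * sq (y - x) - t * (1 - t) * sq (y - z).
  have -> : (1 - t) *: z + t *: y - x = (1 - t) *: (z - x) + t *: (y - x).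
    by rewrite !scalerBr addrACA -opprD -scalerDl subrK scale1r.
  have -> : y - z = (y - x) - (z - x) by rewrite opprB addrA subrK.
  exact: sq_combine.
rewrite -(mulr_natr lambda) -(mulr_natr (lambda * delta)).
rewrite -(ler_pM2l (mulr_gt0 delta0 lambda0)).
set Y := sq (y - x); set X := sq (z - x); set Q := sq (y - z).
have -> : delta * lambda * ((1 - t) / delta * (f q + dot s (y - q) - f z +
    (Y - X + t * Q) / (lambda * 2))) =
    lambda * ((1 - t) * (f q + dot s (y - q) - f z)) + (1 - t) * (Y - X + t * Q) / 2.
  by field; rewrite !gt_eqF.
have -> : delta * lambda * ((f y - f ((1 - t) *: z + t *: y)) / delta +
   (Y - ((1 - t) * X + t * Y - t * (1 - t) * Q)) / (lambda * delta * 2)) =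
   lambda * (f y - f ((1 - t) *: z + t *: y)) +
   (Y - ((1 - t) * X + t * Y - t * (1 - t) * Q)) / 2.
  by field; rewrite !gt_eqF.
have t1' : 0 < 1 - t by rewrite subr_gt0.
have : lambda * ((1 - t) * (f q + dot s (y - q) - f z)) <=
    lambda * (f y - f ((1 - t) *: z + t *: y)).
  rewrite ler_pM2l//; have : (1 - t) * (f q + dot s (y - q)) <= (1 - t) * f y.
    by rewrite ler_pM2l.
  lra.
lra.
Qed.

Lemma gibbs_integral_dilation x z t : 0 < t ->
  RintRd (fun y => w x ((1 - t) *: z + t *: y)) = t ^- d * Z x.
Proof.
move=> t0; apply: RintRd_affine => // [|y]; first exact: gauss_decay_gibbs.
exact/ltW/gibbs_gt0.
Qed.

(* Dilating by t about z multiplies the mass by t^-d, and 1 - t^d <= d (1 - t):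
   this is where the dimension enters, without integrating by parts. *)
Lemma mean_ineq_aux x z q s t : 0 < t -> t < 1 ->
  (forall y, f q + dot s (y - q) <= f y) ->
  0 <= dot s (mean (w x) - q) ->
  t ^+ d * (f q - f z + (var (w x) * (1 + t) + sq (mean (w x) - x) - sq (z - x) +
     t * sq (mean (w x) - z)) / (lambda *+ 2)) <= d%:R * delta.
Proof.
move=> t0 t1 hs hq; set m := mean (w x); set V := var (w x).
pose r := (1 - t) / delta.
have r0 : 0 < r by rewrite divr_gt0// subr_gt0.
pose c := (lambda *+ 2)^-1.
(* [b1] and [a] collect the linear and constant terms when the squared distances to [x] and [z] are
   expanded around the mean [m]. *)
pose b1 := (2 * c) *: ((m - x) + t *: (m - z)).
pose a := 1 + r * (f q - dot s q - f z +
  c * (sq (m - x) - sq (z - x) + t * sq (m - z)) - dot b1 m).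
have gw : gauss_decay (w x) by apply: gauss_decay_gibbs.
have w0 y : 0 < w x y by exact: gibbs_gt0.
have H := @RintRd_ge_quad R d (w x) (fun y => w x ((1 - t) *: z + t *: y))
  a (r *: (s + b1)) (r * c * (1 + t)) gw w0 (gauss_decay_affine ((1 - t) *: z) gw t0).
have {}H : (a + dot (r *: (s + b1)) m + r * c * (1 + t) * V) * Z x <= t ^- d * Z x.
  rewrite -(gibbs_integral_dilation x z t0); apply: H => y.
  apply: le_trans (gibbs_dilation x y z t0 t1 hs).
  rewrite ler_pM2r ?gibbs_gt0// -/m -/r -/c.
  have -> : sq (y - x) = sq (y - m) + 2 * dot (y - m) (m - x) + sq (m - x).
    have -> : y - x = (y - m) + (m - x) by rewrite addrA subrK.
    by rewrite [LHS]sqD mulr_natl.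
  have -> : sq (y - z) = sq (y - m) + 2 * dot (y - m) (m - z) + sq (m - z).
    have -> : y - z = (y - m) + (m - z) by rewrite addrA subrK.
    by rewrite [LHS]sqD mulr_natl.
  have -> : dot (r *: (s + b1)) y = r * (dot s y + dot b1 m +
      2 * c * (dot (y - m) (m - x) + t * dot (y - m) (m - z))).
    rewrite dotZl dotDl -addrA; congr (r * (_ + _)).
    have <- : dot b1 (y - m) = 2 * c * (dot (y - m) (m - x) + t * dot (y - m) (m
      - z)).
      by rewrite /b1 dotZl dotDl dotZl !(dotC (y - m)).
    by rewrite dotDr dotNr addrCA subrr addr0.
  rewrite /a (dotDr _ (- q)) dotNr.
  move: (sq _) (sq _) (sq _) (sq _) (dot _ _) (dot _ _) (dot _ _) (dot _ _) (dot _ _).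
  by move=> *; rewrite le_eqVlt; apply/orP; left; apply/eqP; ring.
have Zx : 0 < Z x by apply: Z_gt0.
rewrite (ler_pM2r Zx) in H.
have td : 0 < t ^+ d by rewrite exprn_gt0.
have bern : 1 - t ^+ d <= d%:R * (1 - t).
  elim: (d) => [|n IH]; first by rewrite expr0 subrr mul0r.
  rewrite exprS (_ : n.+1%:R = n%:R + 1 :> R); last by rewrite natr1.
  have : t ^+ n <= 1 by rewrite exprn_ile1// ltW.
  have := exprn_ge0 n (ltW t0); nra.
set A := f q - f z + _.
have H2 : 1 + r * A <= t ^- d.
  apply: le_trans H; rewrite /a /A -/c.
  have h : 0 <= r * (dot s m - dot s q).
    by rewrite -dotNr -dotDr mulr_ge0// ltW.
  have -> : dot (r *: (s + b1)) m = r * (dot s m + dot b1 m).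
    by rewrite dotZl dotDl.
  rewrite -subr_ge0; apply: le_trans h _.
  move: (sq (m - x)) (sq (z - x)) (sq (m - z)) (dot s m) (dot s q) (dot b1 m).
  by move=> *; rewrite le_eqVlt; apply/orP; left; apply/eqP; ring.
have H3 : t ^+ d * (r * A) <= 1 - t ^+ d.
  have := ler_wpM2l (ltW td) H2; rewrite divff ?gt_eqF//; lra.
have H4 := le_trans H3 bern.
rewrite -(ler_pM2l r0) (mulrCA r) (le_trans H4)//.
by rewrite /r (mulrCA ((1 - t) / delta)) divfK ?gt_eqF.
Qed.

Lemma mean_ineq x z :
  f (mean (w x)) - f z + (2 * var (w x) + sq (mean (w x) - x) - sq (z - x) +
     sq (mean (w x) - z)) / (lambda *+ 2) <= d%:R * delta.
Proof.
apply/ler_addgt0Pr => eta eta0; rewrite -lerBlDr.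
(* [f] need not be differentiable at the mean: a subgradient at a nearby proximal point is used, at
   a loss [eta] that is arbitrary. *)
have [q [s [hq1 hq2 hq3]]] := approx_subgradient (mean (w x)) convf cf xsmin eta0.
set V := var (w x); set m := mean (w x).
pose B (t : R) := t ^+ d * (f m - eta - f z + (V * (1 + t) + sq (m - x) -
  sq (z - x) + t * sq (m - z)) / (lambda *+ 2)).
(* Ratios tending to 1 from below; the exponent n+1 keeps them positive at n = 0. *)
have hB n : B (1 - 2^-1 ^+ n.+1) <= d%:R * delta.
  have p0 : 0 < (2^-1 : R) ^+ n.+1 by rewrite exprn_gt0// invr_gt0.
  have p1 : (2^-1 : R) ^+ n.+1 < 1.
    by rewrite exprn_ilt1 ?invr_ge0// invf_lt1// ltr1n.
  have t0 : 0 < 1 - (2^-1 : R) ^+ n.+1 by rewrite subr_gt0.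
  have t1 : 1 - (2^-1 : R) ^+ n.+1 < 1 by rewrite ltrBlDr ltrDl.
  have := mean_ineq_aux z t0 t1 hq3 hq2; apply: le_trans.
  by rewrite /B ler_pM2l ?exprn_gt0// -/m -/V lerD2r lerD2r.
have l : B (1 - 2^-1 ^+ n.+1) @[n --> \oo] --> B 1.
  have cB : continuous B.
    apply: continuous_fM; first by move=> t; exact: exprn_continuous.
    apply: continuous_fD; first exact: continuous_cstf.
    apply: continuous_fM; last exact: continuous_cstf.
    apply: continuous_fD; last by apply: continuous_fM; [move=> ?; exact:
      cvg_id|exact: continuous_cstf].
    apply: continuous_fD; last exact: continuous_cstf.
    apply: continuous_fD; last exact: continuous_cstf.
    apply: continuous_fM; first exact: continuous_cstf.
    by apply: continuous_fD; [exact: continuous_cstf|move=> ?; exact: cvg_id].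
  apply: (@cvg_comp _ _ _ (fun n => 1 - (2^-1 : R) ^+ n.+1) B \oo (nbhs (1 : R))
    (nbhs (B 1))); last exact: cB.
  have : 1 - (2^-1 : R) ^+ n.+1 @[n --> \oo] --> 1 - (0 : R).
    apply: cvgB; first exact: cvg_cst.
    rewrite (cvg_shiftS (fun n => (2^-1 : R) ^+ n)).
    by apply: cvg_expr; rewrite ger0_norm ?invr_ge0// invf_lt1// ltr1n.
  by rewrite subr0.
have : B 1 <= d%:R * delta by exact: (cvgr_to_le l (nearW _ hB)).
by rewrite /B expr1n !mul1r; lra.
Qed.

Lemma var_le x : var (w x) <= d%:R * lambda * delta.
Proof.
have := mean_ineq x (mean (w x)); move: (var (w x)) => V.
rewrite !subrr sq0 add0r addr0 addrK ler_pdivrMr ?mulrn_wgt0//.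
rewrite -mulr_natl; lra.
Qed.

End moments.

(** * Differentiable convex functions, and the value and gradient bounds *)

Lemma directional_grad (R : realType) d (f : 'rV[R]_d -> R) x h :
  differentiable f x -> 'D_h f x = dot (grad f x) h.
Proof.
move=> df; rewrite deriveE//.
have -> : h = \sum_(i < d) h ord0 i *: delta_mx ord0 i.
  by rewrite [LHS]row_sum_delta.
rewrite linear_sum /dot; apply: eq_bigr => i _.
rewrite linearZ /= mxE deriveE// summxE (bigD1 i)//= big1 => [|j ji].
  by rewrite !mxE !eqxx mulr1 addr0 mulrC.
by rewrite !mxE (eq_sym i) (negPf ji) andbF mulr0.
Qed.

(** Convexity bounds the difference quotients for t in (0, 1] by [f (x + h) - f x], so the
    derivative is taken as a limit from the right. *)
Lemma convex_differentiable_lower (R : realType) d (f : 'rV[R]_d -> R) x h :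
  convex_fun f -> differentiable f x -> f x + dot (grad f x) h <= f (x + h).
Proof.
move=> convf df; rewrite addrC -lerBrDr -directional_grad//.
have dfh : derivable f x h by exact: diff_derivable.
have l : t^-1 *: ((f \o shift x) (t *: h) - f x) @[t --> 0^'+] --> 'D_h f x.
  by apply: cvg_dnbhs_at_right; exact: dfh.
apply: (cvgr_to_le l); near=> t.
have t0 : 0 < t by near: t; exact: nbhs_right_gt.
have t1 : t <= 1 by near: t; exact: nbhs_right_le.
have := convf x (x + h) t (ltW t0) t1.
have -> : (1 - t) *: x + t *: (x + h) = t *: h + x.
  by apply/rowP => i; rewrite !mxE; ring.
move=> H; rewrite -[_ *: _]/(t^-1 * (f (t *: h + x) - f x)).
by rewrite ler_pdivrMl//; lra.
Unshelve. all: by end_near. Qed.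

Section bounds.
Context (R : realType) (d : nat) (delta lambda : R) (f : 'rV[R]_d -> R).
Context (delta0 : 0 < delta) (lambda0 : 0 < lambda).
Context (cf : continuous f) (xs : 'rV[R]_d) (xsmin : forall y, f xs <= f y).
Context (convf : convex_fun f).

Local Notation w := (gibbs delta lambda f).
Local Notation Z := (gibbs_mass delta lambda f).
Local Notation F := (soft_moreau lambda delta f).
Local Notation g x := (lambda^-1 *: (x - mean (w x))).

Lemma mean_value_gap x :
  f (mean (w x)) - f xs <= enorm (g x) * enorm (mean (w x) - xs) + d%:R * delta.
Proof.
have := mean_ineq delta0 lambda0 cf xsmin convf x xs.
set m := mean (w x) => H.
have V0 : 0 <= var (w x) by apply: var_ge0 => y; exact: gibbs_gt0.
(* By polarization the squares in [mean_ineq] collapse to an inner product, which is a multiple of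
   [dot (g x) (m - xs)]; the variance term is nonnegative and is dropped. *)
have e : sq (m - x) - sq (xs - x) + sq (m - xs) = 2 * dot (m - x) (m - xs).
  have E (p q r : 'rV[R]_d) : p - q = (r - q) - (r - p).
    by apply/rowP => i; rewrite !mxE; ring.
  rewrite (E xs x m).
  by rewrite (sqB (m - x)) mulr_natl; ring.
have cs := dot_le_enorm (g x) (m - xs).
have e2 : dot (g x) (m - xs) = - (2 * dot (m - x) (m - xs) / (lambda *+ 2)).
  rewrite dotZl -/m -(opprB m x) dotNl -(mulr_natl lambda).
  by field; rewrite gt_eqF.
have : 0 <= 2 * var (w x) / (lambda *+ 2).
  by apply: divr_ge0; [exact: mulr_ge0|rewrite mulrn_wge0// ltW].
move: H cs; rewrite e2 -e -/m; move: (enorm _ * enorm _).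
rewrite !mulrDl => *; lra.
Qed.

(* Translation invariance of the mass, differentiated in the direction u,
   replaces the identity E[grad f] = grad of the envelope; sq (y - mean) / (2 a)
   + a / 2 majorizes the non-quadratic enorm (y - mean). *)
Lemma grad_gap_aux (L : R) x u a : 0 <= L -> Lsmooth L f -> 0 < a ->
  0 <= dot (grad f x) u + enorm u * L * (enorm (mean (w x) - x) +
     (a / 2 + var (w x) / (2 * a))) + dot (mean (w x) - x) u / lambda.
Proof.
move=> L0 [df lipf] a0.
have gw : gauss_decay (w x) by apply: gauss_decay_gibbs.
have w0 y : 0 < w x y by exact: gibbs_gt0.
set m := mean (w x); set V := var (w x); set p := grad f x.
(* The parameter [h] is the length of the translation along [u]. Terms of second order in [h] become
   this multiple of [h] once the factor [k = h / delta] is removed. *)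
apply: (@ge0_of_affine_ge0 _ _ (enorm u * L * enorm u + sq u / (2 * lambda))).
move=> h h0 h1.
pose k := (h / delta).
have k0 : 0 < k by rewrite divr_gt0.
pose b := - (k / lambda) *: u.
pose a1 := 1 - k * (dot p u + enorm u * L * (enorm (m - x) + h * enorm u + a / 2) +
  h * sq u / (2 * lambda) - dot x u / lambda).
pose e := - (k * (enorm u * L / (2 * a))).
have H : (a1 + dot b m + e * V) * RintRd (w x) <= RintRd (fun y => w x (h *: u +
  1 *: y)).
  apply: RintRd_ge_quad => //; first exact: gauss_decay_affine.
  move=> y; rewrite scale1r (addrC (h *: u)).
  have E (r1 r2 r3 : R) : r1 + r2 + r3 = 1 + (r1 - 1 + r2 + r3) by ring.
  rewrite (E a1).
  apply: gibbs_ge_exp => //.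
  (* The increment is bounded by the gradient at the shifted point, which the Lipschitz condition
     then compares with the gradient at [x]. *)
  have fy : f (y + h *: u) - f y <= h * dot (grad f (y + h *: u)) u.
    have := convex_differentiable_lower (- (h *: u)) convf (df (y + h *: u)).
    by rewrite addrK dotNr dotZr; lra.
  have gy : dot (grad f (y + h *: u)) u <= dot p u + enorm u * L *
      (enorm (m - x) + h * enorm u + a / 2 + sq (y - m) / (2 * a)).
    have -> : dot (grad f (y + h *: u)) u = dot p u + dot (grad f (y + h *: u) - p) u.
      by rewrite -dotDl addrCA subrr addr0.
    rewrite lerD2l; apply: le_trans (dot_le_enorm _ _) _.
    rewrite mulrC -mulrA ler_wpM2l ?enorm_ge0//.
    apply: le_trans (lipf _ _) _; rewrite ler_wpM2l//.
    have -> : y + h *: u - x = (m - x) + h *: u + (y - m).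
      by apply/rowP => i; rewrite !mxE; ring.
    apply: le_trans (enormD _ _) _.
    rewrite -(addrA (enorm (m - x) + h * enorm u)) lerD//.
      by apply: le_trans (enormD _ _) _; rewrite enormZ gtr0_norm.
    have : 0 <= (enorm (y - m) - a) ^+ 2 / (2 * a).
      by rewrite divr_ge0 ?sqr_ge0// mulr_ge0// ltW.
    rewrite sqrrB enorm_sqr -mulr_natr.
    have -> : (sq (y - m) - enorm (y - m) * a * 2 + a ^+ 2) / (2 * a) =
      sq (y - m) / (2 * a) - enorm (y - m) + a / 2 by field; rewrite gt_eqF.
    lra.
  have sx : sq (y - x) - sq (y + h *: u - x) = - (2 * h * (dot y u - dot x u)) -
    h ^+ 2 * sq u.
    have -> : y + h *: u - x = (y - x) + h *: u by rewrite addrAC.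
    by rewrite (sqD (y - x)) sqZ dotZr dotDl dotNl -mulr_natl; ring.
  rewrite sx.
  have key : - (h * (dot p u + enorm u * L *
      (enorm (m - x) + h * enorm u + a / 2 + sq (y - m) / (2 * a)))) / delta <=
      (f y - f (y + h *: u)) / delta.
    rewrite ler_pM2r ?invr_gt0//; have := ler_wpM2l (ltW h0) gy; lra.
  apply: le_trans (lerD key (lexx _)).
  rewrite le_eqVlt; apply/orP; left; apply/eqP.
  rewrite /a1 /b /e /k dotZl (dotC u) -mulr_natl.
  by field; rewrite !gt_eqF.
have {}H : a1 + dot b m + e * V <= 1.
  have Zx : 0 < RintRd (w x) by exact: RintRd_gt0.
  rewrite -(ler_pM2r Zx) (le_trans H)// RintRd_affine// => [|y]; last exact: ltW.
  by rewrite expr1n invr1.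
rewrite -(ler_pM2l k0) mulr0.
have {}H : 0 <= 1 - (a1 + dot b m + e * V) by rewrite subr_ge0.
suff <- : 1 - (a1 + dot b m + e * V) =
  k * (dot p u + enorm u * L * (enorm (m - x) + (a / 2 + V / (2 * a))) +
   dot (m - x) u / lambda + h * (enorm u * L * enorm u + sq u / (2 * lambda))) by [].
rewrite /a1 /b /e dotZl dotDl dotNl (dotC u).
by field; rewrite !gt_eqF.
Qed.

Lemma grad_gap (L : R) x : 0 <= L -> Lsmooth L f ->
  enorm (grad f x) <= (1 + lambda * L) * enorm (g x) +
    L * Num.sqrt (d%:R * lambda * delta).
Proof.
move=> L0 hL; set p := grad f x; set a := Num.sqrt _.
(* Dimension 0 is treated apart because [a] has to be positive below. *)
have [d0|dpos] := posnP d.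
  have -> : enorm p = 0.
    rewrite /enorm big1 ?sqrtr0// => i _; exfalso.
    by have := ltn_ord i; rewrite {2}d0.
  by rewrite addr_ge0// mulr_ge0 ?enorm_ge0 ?sqrtr_ge0// addr_ge0// mulr_ge0// ltW.
have v0 : 0 < d%:R * lambda * delta by rewrite !mulr_gt0// ltr0n.
have a0 : 0 < a by rewrite sqrtr_gt0.
have Vle : var (w x) <= a ^+ 2.
  by rewrite sqr_sqrtr ?(ltW v0)//; exact: var_le.
have [p0|p0] := eqVneq (enorm p) 0.
  rewrite p0 addr_ge0// mulr_ge0 ?enorm_ge0 ?(ltW a0)//.
  by rewrite addr_ge0// mulr_ge0// ltW.
have pp : 0 < enorm p by rewrite lt_def p0 enorm_ge0.
(* The direction opposite to the gradient makes |p|^2 appear, and one factor |p| is cancelled at the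
   end. With a^2 = d lambda delta, the variance bound gives a/2 + V/(2a) <= a. *)
have := grad_gap_aux x (- p) L0 hL a0.
rewrite dotNr dotvv enormN -/p dotNr -enorm_sqr.
have mx : enorm (mean (w x) - x) = lambda * enorm (g x).
  by rewrite enormZ gtr0_norm ?invr_gt0// mulrA divff ?gt_eqF// mul1r -enormN opprB.
rewrite mx.
have dg : - dot (mean (w x) - x) p / lambda <= enorm (g x) * enorm p.
  apply: le_trans (dot_le_enorm _ _); rewrite dotZl -(opprB _ x) dotNl mulrC.
  by rewrite lexx.
have hV : a / 2 + var (w x) / (2 * a) <= a.
  have : var (w x) / (2 * a) <= a ^+ 2 / (2 * a).
    by rewrite ler_pM2r// invr_gt0 mulr_gt0.
  have -> : a ^+ 2 / (2 * a) = a / 2 by field; rewrite gt_eqF.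
  lra.
have h2 : enorm p * L * (lambda * enorm (g x) + (a / 2 + var (w x) / (2 * a))) <=
    enorm p * L * (lambda * enorm (g x) + a).
  by rewrite ler_wpM2l ?mulr_ge0 ?enorm_ge0// lerD2l.
move=> H; rewrite -(ler_pM2l pp).
move: H dg h2; rewrite -/p; move: (enorm p) (enorm (g x)) (_ / lambda) (var _).
move=> P G D V H dg h2; lra.
Qed.

Lemma smooth_value_gap (L : R) x : Lsmooth L f ->
  f x - f xs <= enorm (grad f x) * enorm (x - xs).
Proof.
move=> [df _].
have := convex_differentiable_lower (xs - x) convf (df x).
rewrite addrCA subrr addr0 => h.
have := dot_le_enorm (grad f x) (x - xs).
rewrite -(opprB xs x) dotNr enormN; lra.
Qed.

End bounds.

(** * Existence of a minimizer of the envelope *)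

(** Stands in for a limit at 0: beyond a near-maximal [c0], no value of [b] gains more than
    [eps]. *)
Lemma sup_adherent_fun (R : realType) (b : R -> R) (M : R) :
  (forall c, 0 < c -> 0 <= b c <= M) ->
  exists2 S, 0 <= S & forall eps, 0 < eps ->
    (exists2 c0, 0 < c0 & forall c, 0 < c -> b c <= S /\ b c <= b c0 + eps).
Proof.
move=> hb; pose A := [set b c | c in [set c : R | 0 < c]].
have sA : has_sup A.
  split; first by exists (b 1), 1; rewrite /=.
  by exists M => _ [c c0 <-]; case/andP: (hb c c0).
have ub c : 0 < c -> b c <= sup A.
  by move=> c0; apply: ub_le_sup; [exact: sA.2|exists c].
exists (sup A); first by apply: le_trans (ub 1 ltr01); case/andP: (hb 1 ltr01).
move=> eps eps0; have [_ [c0 c00 <-] hc] := sup_adherent eps0 sA.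
exists c0 => // c c0'; split; first exact: ub.
by have := ub c c0'; lra.
Qed.

Section existence.
Context (R : realType) (d : nat) (delta lambda : R) (f : 'rV[R]_d -> R).
Context (delta0 : 0 < delta) (lambda0 : 0 < lambda).
Context (cf : continuous f) (xs : 'rV[R]_d) (xsmin : forall y, f xs <= f y).
Context (intf : (eintRd (fun y => (expR (- f y / delta))%:E) < +oo)%E).

Local Notation w := (gibbs delta lambda f).
Local Notation Z := (gibbs_mass delta lambda f).
Local Notation u := (fun y => expR (- f y / delta)).

Lemma gauss_decay_damped (z : 'rV[R]_d) (c : R) : 0 < c ->
  gauss_decay (fun y => u y * expR (- (c * sq (y - z)))).
Proof.
move=> c0; exists (c / 2), (expR (- f xs / delta + c * sq z)).
split; first by rewrite divr_gt0.
split.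
  apply: continuous_fM; apply: (@continuous_compf _ _ _ _ (@expR R)); try exact:
    continuous_expR.
    by apply: continuous_fM; [exact: continuous_fN|exact: continuous_cstf].
  apply: continuous_fN; apply: continuous_fM; first exact: continuous_cstf.
  exact: (quad_growth_sq z).1.
move=> y; rewrite ger0_norm ?mulr_ge0 ?expR_ge0// -!expRD ler_expR -addrA lerD//.
  by rewrite ler_pM2r ?invr_gt0// lerN2.
have := sqD_le (y - z) z; rewrite subrK => h.
by have := ler_wpM2l (ltW c0) h; lra.
Qed.

Lemma gibbs_damped x y : w x y = (Num.sqrt (pi *+ 2 * (lambda * delta))) ^- d *
  (u y * expR (- ((lambda * delta *+ 2)^-1 * sq (y - x)))).
Proof. by rewrite gibbsE expRD [(lambda * delta *+ 2)^-1 * _]mulrC. Qed.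

(** For x far away the Gaussian kills the mass near the origin, while the remaining mass is a tail
    of the integrable [expR (- f y / delta)]. The smooth cutoff exp(-c0 |y|^2) plays the role of the
    indicator of a ball. *)
Lemma gibbs_mass_vanishes eps : 0 < eps ->
  exists rho, forall x, rho < sq x -> Z x < eps.
Proof.
move=> eps0; set N := (Num.sqrt (pi *+ 2 * (lambda * delta))) ^- d : R.
have N0 : 0 < N by apply: gauss_norm_gt0.
pose b c := RintRd (fun y => u y * expR (- (c * sq (y - 0)))).
pose M := fine (eintRd (fun y => (u y)%:E)).
have e0 : (0 <= eintRd (fun y => (u y)%:E))%E.
  by apply: eintRd_ge0 => y; rewrite lee_fin expR_ge0.
have hb c : 0 < c -> 0 <= b c <= M.
  move=> c0; apply/andP; split.
    by apply: RintRd_ge0 => y; rewrite mulr_ge0 ?expR_ge0.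
  rewrite -lee_fin /M fineK; last by rewrite ge0_fin_numE.
  rewrite /b -eintRd_RintRd; last 2 first.
  - exact: gauss_decay_damped.
  - by move=> y; rewrite mulr_ge0 ?expR_ge0.
  apply: eintRd_le => y; first by rewrite lee_fin mulr_ge0 ?expR_ge0.
  rewrite lee_fin ler_piMr ?expR_ge0// -[leRHS]expR0 ler_expR oppr_le0.
  by rewrite mulr_ge0 ?sq_ge0// ltW.
have [S S0 hS] := sup_adherent_fun hb.
pose e := eps / (4 * N).
have ee : 0 < e by rewrite divr_gt0// mulr_gt0.
have [c0 c00 hc] := hS _ ee.
pose s := (lambda * delta *+ 2)^-1.
have s0 : 0 < s by rewrite invr_gt0 mulrn_wgt0// mulr_gt0.
(* Chosen so that kappa |x|^2 <= 2 kappa (|x - y|^2 + |y|^2) <= s |x - y|^2 + (c0 / 2) |y|^2. *)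
pose kappa := Num.min (s / 2) (c0 / 4).
have k0 : 0 < kappa by rewrite lt_min !divr_gt0.
(* Beyond this radius S <= e kappa |x|^2 <= e exp(kappa |x|^2), which makes the central part at most
   [e]. *)
exists (S / (kappa * e)) => x hx.
pose I := RintRd (fun y => u y * expR (- (s * sq (y - x)))).
have -> : Z x = N * I.
  rewrite /gibbs_mass /I -RintRdZ; last exact: gauss_decay_damped.
  by apply: eq_RintRd => y; exact: gibbs_damped.
pose Q := RintRd (fun y => sq (y - 0) * (u y * expR (- (s * sq (y - x))))).
have gs c : 0 < c -> gauss_decay (fun y => u y * expR (- (c * sq (y - 0)))).
  exact: gauss_decay_damped.
have tail : I <= expR (- (kappa * sq x)) * S + e.
  rewrite -subr_ge0; apply: (@ge0_of_affine_ge0 _ _ (c0 * Q)) => t t0 t1.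
  have tc0 : 0 < t * c0 by rewrite mulr_gt0.
  (* b is bounded by the integral of exp (- f / delta), hence almost constant near
     0; only bounded continuous functions with Gaussian decay are integrated. *)
  have H : I <= expR (- (kappa * sq x)) * b (c0 / 2) + (b (t * c0) + (-1) * b c0)
    + t * c0 * Q.
    rewrite /I /b /Q.
    have g1 : gauss_decay (fun y => expR (- (kappa * sq x)) * (u y * expR (- (c0
      / 2 * sq (y - 0))))).
      by apply: gauss_decayZ; apply: gs; rewrite divr_gt0.
    have g2 := gs _ tc0.
    have g3 : gauss_decay (fun y => (-1) * (u y * expR (- (c0 * sq (y - 0))))).
      by apply: gauss_decayZ; exact: gs.
    have g4 : gauss_decay (fun y => sq (y - 0) * (u y * expR (- (s * sq (y - x))))).
      by apply: gauss_decay_mul; [exact: quad_growth_sq|exact: gauss_decay_damped].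
    have g5 : gauss_decay (fun y => t * c0 * (sq (y - 0) * (u y * expR (- (s * sq
      (y - x)))))).
      exact: gauss_decayZ.
    have g23 := gauss_decayD g2 g3.
    have g123 := gauss_decayD g1 g23.
    rewrite -(RintRdZ (t * c0) g4) -(RintRdZ (-1) (gs _ c00)).
    rewrite -(RintRdZ (expR (- (kappa * sq x))) (gs (c0 / 2) _)) ?divr_gt0//.
    rewrite -(RintRdD g2 g3) -(RintRdD g1 g23) -(RintRdD g123 g5).
    apply: RintRd_le; [exact: gauss_decay_damped|exact: gauss_decayD|move=> y].
    rewrite subr0.
    set q := s * sq (y - x); set y2 := sq y.
    have q0 : 0 <= q by rewrite mulr_ge0 ?sq_ge0// ltW.
    have y20 : 0 <= y2 by exact: sq_ge0.
    have E0 : 0 <= expR (- f y / delta) by exact: expR_ge0.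
    (* With P = exp(-q), E1 = exp(-c0 |y|^2) and Et = exp(-t c0 |y|^2), split P = P E1 + P (Et - E1)
       + P (1 - Et) and bound the three pieces in turn. *)
    suff : expR (- q) <= expR (- (kappa * sq x)) * expR (- (c0 / 2 * y2)) +
        (expR (- (t * c0 * y2)) - expR (- (c0 * y2))) + t * c0 * (y2 * expR (- q)).
      by move=> h; have := ler_wpM2l E0 h; lra.
    have h1 : expR (- q) * expR (- (c0 * y2)) <=
        expR (- (kappa * sq x)) * expR (- (c0 / 2 * y2)).
      rewrite -!expRD ler_expR.
      have k1 : kappa <= s / 2 by rewrite ge_min lexx.
      have k2 : kappa <= c0 / 4 by rewrite ge_min lexx orbT.
      have := sqD_le (x - y) y; rewrite subrK (sqBC x) => h.
      have a1 := ler_wpM2l (ltW k0) h.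
      have a2 : kappa * sq (y - x) <= s / 2 * sq (y - x).
        by rewrite ler_wpM2r ?sq_ge0.
      have a3 : kappa * y2 <= c0 / 4 * y2 by rewrite ler_wpM2r.
      by move: a1 a2 a3; rewrite /q /y2; lra.
    have h2 : 1 - t * c0 * y2 <= expR (- (t * c0 * y2)) by exact: expR_ge1Dx.
    have h3 : expR (- (c0 * y2)) <= expR (- (t * c0 * y2)).
      rewrite ler_expR lerN2 ler_wpM2r//.
      by rewrite ler_piMl// ltW.
    have h4 : expR (- q) <= 1 by rewrite -[leRHS]expR0 ler_expR oppr_le0.
    have p0 : 0 <= expR (- q) by exact: expR_ge0.
    have h5 := ler_wpM2l p0 h2.
    have h6 : expR (- q) * (expR (- (t * c0 * y2)) - expR (- (c0 * y2))) <=
        expR (- (t * c0 * y2)) - expR (- (c0 * y2)).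
      by rewrite ler_piMl// subr_ge0.
    by move: h1 h5 h6; lra.
  have [b1 _] := hc (c0 / 2) (divr_gt0 c00 (ltr0n _ 2)).
  have [_ b2] := hc (t * c0) tc0.
  have b3 : expR (- (kappa * sq x)) * b (c0 / 2) <= expR (- (kappa * sq x)) * S.
    by rewrite ler_wpM2l ?expR_ge0.
  by move: H b2 b3; lra.
have small : expR (- (kappa * sq x)) * S <= e.
  have h1 : S <= e * (kappa * sq x).
    have ke : 0 < kappa * e by exact: mulr_gt0.
    have := ltW hx; rewrite (ler_pdivrMr _ _ ke).
    by rewrite [e * _]mulrA [_ * sq x]mulrC (mulrC e).
  have h2 : kappa * sq x <= expR (kappa * sq x).
    by apply: le_trans (expR_ge1Dx _); rewrite lerDr.
  have h3 := le_trans h1 (ler_wpM2l (ltW ee) h2).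
  have := ler_wpM2l (expR_ge0 (- (kappa * sq x))) h3.
  by rewrite mulrCA -expRD addNr expR0 mulr1.
have : N * I <= N * (2 * e) by rewrite ler_pM2l//; lra.
move=> h; apply: (le_lt_trans h); rewrite /e.
have -> : N * (2 * (eps / (4 * N))) = eps / 2 by field; rewrite gt_eqF.
lra.
Qed.

Lemma soft_moreau_has_minimizer : convex_fun f ->
  exists y0, forall y, soft_moreau lambda delta f y0 <= soft_moreau lambda delta f y.
Proof.
move=> convf.
have up := soft_moreau_upper delta0 lambda0 cf xsmin.
have mid := soft_moreau_midpoint delta0 lambda0 cf xsmin convf.
have Z0 x : 0 < Z x by apply: Z_gt0.
(* With the threshold [Z 0], points outside the ball have a larger envelope value than the origin,
   so the sublevel set is bounded. *)
have [rho hrho] := gibbs_mass_vanishes (Z0 0).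
apply: (@exists_minimizer _ _ _ 0 rho).
  (* Continuity of the envelope at [x]: it is squeezed between the two paraboloids touching
     there. *)
  move=> x; set F := soft_moreau _ _ _.
  have hlo h := lower_quad up mid x h.
  set gx := lambda^-1 *: _ in hlo.
  have l0 : (fun y => F x + dot gx (y - x) + sq (y - x) / (lambda *+ 2)) y @[y
    --> x] --> F x.
    have c : continuous (fun y => F x + (dot gx y + - dot gx x) + sq (y - x) *
      (lambda *+ 2)^-1).
      apply: continuous_fD; last by apply: continuous_fM; [exact: (quad_growth_sq
        x).1|exact: continuous_cstf].
      apply: continuous_fD; first exact: continuous_cstf.
      by apply: continuous_fD; [exact: dot_continuous|exact: continuous_cstf].
    have := c x; rewrite /continuous_at !subrr sq0 mul0r !addr0.
    by under eq_fun do rewrite -dotNr -dotDr.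
  have l1 : (fun y => F x + dot gx (y - x) - sq (y - x) / (lambda *+ 2)) y @[y
    --> x] --> F x.
    have c : continuous (fun y => F x + (dot gx y + - dot gx x) + sq (y - x) * -
      (lambda *+ 2)^-1).
      apply: continuous_fD; last by apply: continuous_fM; [exact: (quad_growth_sq
        x).1|exact: continuous_cstf].
      apply: continuous_fD; first exact: continuous_cstf.
      by apply: continuous_fD; [exact: dot_continuous|exact: continuous_cstf].
    have := c x; rewrite /continuous_at !subrr sq0 mul0r !addr0.
    by under eq_fun do rewrite -dotNr -dotDr mulrN.
  apply: (squeeze_cvgr _ l1 l0); apply: nearW => y.
  have := hlo (y - x); have := up x (y - x).
  by rewrite addrCA subrr addr0 => -> ->.
move=> y h; rewrite leNgt; apply/negP => /hrho; apply/negP; rewrite -leNgt.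
move: h; rewrite !soft_moreauE; move: (Z y) (Z 0) (Z0 y) (Z0 0) => a b a0 b0.
by rewrite !mulNr lerN2 ler_pM2l// ler_ln ?posrE.
Qed.

End existence.

(** * From bounds at each minimizer to bounds by the distance, and the final assembly *)

Lemma le_dist (R : realType) d (x : 'rV[R]_d) (A : set 'rV[R]_d) (c b e : R) :
  A !=set0 -> 0 <= c -> (forall a, A a -> b <= c * enorm (x - a) + e) ->
  b <= c * dist x A + e.
Proof.
move=> [a0 Aa0]; rewrite le_eqVlt => /predU1P[<-|c0] h.
  by have := h _ Aa0; rewrite !mul0r.
rewrite -lerBlDr -ler_pdivrMl//; apply: lb_le_inf.
  by exists (enorm (x - a0)), a0.
move=> _ [a Aa <-]; rewrite ler_pdivrMl// lerBlDr; exact: h.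
Qed.

Lemma minvalE (R : realType) d (f : 'rV[R]_d -> R) (xs : 'rV[R]_d) :
  argmin f xs -> minval f = f xs.
Proof.
move=> h; apply/eqP; rewrite eq_le; apply/andP; split.
  apply: ge_inf; last by exists xs.
  by exists (f xs) => _ [y _ <-]; exact: h.
apply: lb_le_inf; first by exists (f xs), xs.
by move=> _ [y _ <-]; exact: h.
Qed.

Theorem theorem6 (R : realType) (d : nat) (delta lambda : R)
  (f : 'rV[R]_d -> R) (x : nat -> 'rV[R]_d) :
  0 < delta -> 0 < lambda ->
  convex_fun f ->
  continuous f ->
  argmin f !=set0 ->
  (eintRd (fun y => (expR (- f y / delta))%:E) < +oo)%E ->
  (forall k, x k.+1 = zprox delta lambda f (x k)) ->
  (* (i) *)
  (forall k, (1 <= k)%N ->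
     f (x k) - minval f <=
       enorm (grad (soft_moreau lambda delta f) (x k.-1)) * dist (x k) (argmin f)
       + d%:R * delta)
  /\
  (* (ii) *)
  (forall L : R, 0 <= L -> Lsmooth L f ->
     forall k,
       enorm (grad f (x k)) <=
         (1 + lambda * L) * enorm (grad (soft_moreau lambda delta f) (x k))
         + L * Num.sqrt (d%:R * lambda * delta)
     /\
       f (x k) - minval f <=
         ((1 + lambda * L) * enorm (grad (soft_moreau lambda delta f) (x k))
          + L * Num.sqrt (d%:R * lambda * delta)) * dist (x k) (argmin f))
  /\
  (* bound on the gradient of the envelope *)
  (forall k, (1 <= k)%N ->
     enorm (grad (soft_moreau lambda delta f) (x k)) <=
       2 * dist (x 0%N) (argmin (soft_moreau lambda delta f)) / (lambda * k.+1%:R)).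
Proof.
move=> delta0 lambda0 convf cf [xs xsmin] intf xS.
set F := soft_moreau lambda delta f.
have up : upper_quad lambda F (fun x => lambda^-1 *: (x - zprox delta lambda f x)).
  exact: soft_moreau_upper delta0 lambda0 cf _ xsmin.
have mid : midpoint_convex F by exact: soft_moreau_midpoint delta0 lambda0 cf _ xsmin convf.
have gradF := grad_quad lambda0 up mid.
have argf0 : argmin f !=set0 by exists xs.
split; [|split].
- case=> [//|k] _ /=; rewrite gradF xS; apply: le_dist => // [|a amin].
    exact: enorm_ge0.
  rewrite (minvalE amin) zproxE.
  exact: mean_value_gap.
- move=> L L0 hL k; rewrite gradF zproxE.
  have G := grad_gap delta0 lambda0 cf xsmin convf (x k) L0 hL.
  split=> //; rewrite -[_ * dist _ _]addr0; apply: le_dist => //.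
    exact: le_trans (enorm_ge0 _) G.
  move=> a amin; rewrite addr0 (minvalE amin).
  apply: le_trans (smooth_value_gap a convf (x k) hL) _.
  by rewrite ler_wpM2r ?enorm_ge0.
- move=> k k1; rewrite gradF.
  have [y0 hy0] := soft_moreau_has_minimizer delta0 lambda0 cf xsmin intf convf.
  rewrite mulrAC -[_ * dist _ _]addr0; apply: le_dist.
  + by exists y0.
  + by rewrite divr_ge0// mulr_ge0// ltW.
  move=> a amin; rewrite addr0 mulrAC.
  (* The proximal iteration rewritten as gradient descent with step [lambda] on the envelope. *)
  have step n : x n.+1 = x n - lambda *: (lambda^-1 *: (x n - zprox delta lambda f (x n))).
    by rewrite xS scalerA divff ?gt_eqF// scale1r opprB addrC subrK.
  exact: (gd_rate lambda0 up (first_order_convex up mid) step amin k1).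
Qed.
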